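(* Let $k\ge 1$ and consider the linear regression model $y_t = x_t'\theta+\epsilon_t$, $1\le t\le n$, $n\ge 1$, with unknown parameter $\theta\in\mathbb{R}^k$, where: (a) $(x_t)_{t\ge1}$ is a sequence of nonstochastic vectors in $\mathbb{R}^k$ such that $n^{-1}\sum_{t=1}^n x_t x_t'\to Q$ as $n\to\infty$ for some positive definite matrix $Q$; (b) the errors $\epsilon_t$ are independent and identically distributed with mean zero and variance $1$, and have a density $f$ (with respect to Lebesgue measure on $\mathbb{R}$) that possesses an absolutely continuous derivative $df/dx$ satisfying $$0<\int_{-\infty}^{\infty}\left(\frac{df(x)/dx}{f(x)}\right)^2 f(x)\,dx<\infty .$$ Let $P_{n,\theta}$ denote the distribution of the sample $(y_1,\dots,y_n)'$ when the parameter is $\theta$, and let $E_{n,\theta}$ be the corresponding expectation. Let $\hat\theta=\hat\theta_n$ be an arbitrary estimator for $\theta$ based on $(y_1,\dots,y_n)'$ that satisfies the following sparsity-type condition: for every $\theta\in\mathbb{R}^k$, $$P_{n,\theta}\big(r(\hat\theta)\le r(\theta)\big)\to 1\quad\text{as } n\to\infty,$$ where $r(\theta)\in\{0,1\}^k$ has components $r_i(\theta)=0$ if $\theta_i=0$ and $r_i(\theta)=1$ if $\theta_i\ne0$, and the inequality is componentwise. Then the maximal (scaled) mean squared error of $\hat\theta$ diverges to infinity: $$\sup_{\theta\in\mathbb{R}^k}E_{n,\theta}\big[n(\hat\theta-\theta)'(\hat\theta-\theta)\big]\to\infty\quad\text{as } n\to\infty .$$ More generally, let $l:\mathbb{R}^k\to\mathbb{R}$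 be a nonnegative (Borel measurable) loss function. Then $$\sup_{\theta\in\mathbb{R}^k}E_{n,\theta}\,l\big(n^{1/2}(\hat\theta-\theta)\big)\to\sup_{s\in\mathbb{R}^k}l(s)\quad\text{as } n\to\infty .$$ In particular, if $l$ is unbounded, then the maximal risk $\sup_{\theta\in\mathbb{R}^k}E_{n,\theta}\,l(n^{1/2}(\hat\theta-\theta))$ diverges to infinity as $n\to\infty$.
   Context: The prime denotes transposition; vectors are column vectors. An estimator $\hat\theta$ means a sequence $(\hat\theta_n)_{n\ge1}$ in which each $\hat\theta_n$ is an $\mathbb{R}^k$-valued measurable function of the sample $(y_1,\dots,y_n)'$ (it may depend on the known nonstochastic regressors $x_1,\dots,x_n$ and on $n$, but not on $\theta$). Expectations of nonnegative random variables and suprema take values in $[0,\infty]$; convergence to $\sup_s l(s)$ is understood in $[0,\infty]$, i.e. it means divergence to $\infty$ when $l$ is unbounded. In the Fisher information integral in (b), the integrand is interpreted as $0$ where $f$ vanishes. *)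

(* Defs.v *)
From HB Require Import structures.
From mathcomp Require Import all_boot all_order all_algebra finmap.
From mathcomp Require Import all_classical all_reals all_analysis.
From mathcomp Require Import measurable_realfun.

Set Implicit Arguments.
Unset Strict Implicit.
Unset Printing Implicit Defensive.

Import Order.TTheory GRing.Theory Num.Theory.
Import numFieldNormedType.Exports.

Local Open Scope classical_set_scope.
Local Open Scope ring_scope.

Definition positive_definite (R : realType) (k : nat) (Q : 'M[R]_k) : Prop :=
  Q^T = Q /\ forall v : 'cV[R]_k, v != 0 -> 0 < (v^T *m Q *m v) ord0 ord0.

(* R^k with the sigma-algebra generated by its open sets. *)
Definition borelRk (R : realType) (k : nat) :=
  g_sigma_algebraType (@open 'cV[R]_k).

(* Mutual independence: the product rule over every finite subfamily. *)
Definition mutually_independent (R : realType) (d : measure_display)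
    (T : measurableType d) (P : probability T R)
    (X : nat -> {RV P >-> R}) : Prop :=
  forall (J : {fset nat}) (A : nat -> set R),
    (forall t, measurable (A t)) ->
    P (\bigcap_(t in [set` J]) (X t @^-1` A t)) =
    (\prod_(t <- J) P (X t @^-1` A t))%E.
Arguments mutually_independent {R d T} P X.

Definition has_density (R : realType) (d : measure_display)
    (T : measurableType d) (P : probability T R)
    (X : {RV P >-> R}) (f : R -> R) : Prop :=
  [/\ measurable_fun [set: R] f,
      forall z, 0 <= f z
    & forall A : set R, measurable A ->
        distribution P X A = (\int[lebesgue_measure]_(z in A) (f z)%:E)%E].
Arguments has_density {R d T} P X f.

Definition absolutely_continuous_on (R : realType) (a b : R) (g : R -> R) :
    Prop :=
  forall e : R, 0 < e -> exists2 delta : R, 0 < delta &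
    forall (m : nat) (u v : nat -> R),
      (forall i, (i < m)%N -> [/\ a <= u i, u i <= v i & v i <= b]) ->
      trivIset `I_m (fun i => `]u i, v i[%classic) ->
      \sum_(i < m) (v i - u i) < delta ->
      \sum_(i < m) `|g (v i) - g (u i)| < e.

(* On the unbounded domain R, absolute continuity is understood on every
   compact interval. *)
Definition absolutely_continuous (R : realType) (g : R -> R) : Prop :=
  forall a b : R, absolutely_continuous_on a b g.

(* The integrand is 0 where f vanishes, because of the factor f z. *)
Definition fisher_information (R : realType) (f : R -> R) : \bar R :=
  (\int[lebesgue_measure]_z ((derive1 f z / f z) ^+ 2 * f z)%:E)%E.

Section linear_model.
Context (R : realType) (k : nat) (d : measure_display) (T : measurableType d).
Context (P : probability T R) (x : nat -> 'cV[R]_k) (eps : nat -> {RV P >-> R}).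
Implicit Types (n : nat) (theta : 'cV[R]_k).

(* Time is indexed from 0: x t, eps t and component t of the sample stand for
   x_{t+1}, epsilon_{t+1} and y_{t+1}. *)
Definition sample n theta (w : T) : n.-tuple R :=
  [tuple ((x t)^T *m theta) ord0 ord0 + eps t w | t < n].

Lemma measurable_sample n theta : measurable_fun [set: T] (sample n theta).
Proof.
apply/measurable_fun_tnthP => i.
rewrite (_ : _ \o _ =
  (fun w => ((x i)^T *m theta) ord0 ord0 + eps i w)); last first.
  by apply/funext => w /=; rewrite tnth_mktuple.
by apply: measurable_funD; [exact: measurable_cst|exact: measurable_funPT].
Qed.

HB.instance Definition _ n theta :=
  isMeasurableFun.Build _ _ _ _ (sample n theta) (@measurable_sample n theta).

(* P_{n,theta}; n.-tuple R carries the product (equivalently Borel)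
   sigma-algebra of R^n. *)
Definition sample_law n theta : probability (n.-tuple R) R :=
  distribution P (sample n theta).

End linear_model.
Arguments sample_law {R k d T} P x eps n theta.

Definition nonzero_pattern (R : realType) (k : nat) (theta : 'cV[R]_k) :
    'cV[nat]_k :=
  \col_i (theta i ord0 != 0 : nat).

(* Main.v *)
Require Import Defs.
From mathcomp Require Import all_boot all_order all_algebra finmap.
From mathcomp Require Import all_classical all_reals all_analysis.
From mathcomp Require Import measurable_realfun ring lra.

Set Implicit Arguments.
Unset Strict Implicit.
Unset Printing Implicit Defensive.

Import Order.TTheory GRing.Theory Num.Theory.
Import numFieldNormedType.Exports.
Import HBSimple HBNNSimple.

Local Open Scope classical_set_scope.
Local Open Scope ring_scope.

(** At theta_n = - s / sqrt n, the scaled error of an estimator that vanishes is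
    exactly s, so the maximal risk is asymptotically at least l s as soon as the
    probability that the estimator vanishes tends to 1 under theta_n.  Sparsity
    gives this under theta = 0, and contiguity transfers it to theta_n.
    Contiguity is obtained without log-likelihoods: with the likelihood ratio of
    each observation truncated at 4, the probability under theta_n is at most
    M times the one under 0, plus the second moment of the truncated ratio over
    M, plus the probability that some ratio exceeds 4.  The square root of the
    density has increments controlled in L^2 by the Fisher information; this
    bounds the second moment by prod (1 + O(h_t^2)), with h_t = x_t' theta_n, and
    the excess probability by o(sum h_t^2). *)

(** The obstacle is that [f] may vanish: the shifted law need not be absolutely continuous with
    respect to the unshifted one, logarithms of ratios are undefined, and an untruncated ratio may
    have infinite second moment. Since the sums of [h_t^2] stay bounded without tending to 0, the
    errors per observation must be of exact orders. The mass lost by truncation has to be [o(h^2)],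
    not merely [O(h^2)]: it sits where [f] changes by a factor above 4 within distance [|h|], and
    the Fisher information of the neighbourhood of such points vanishes with [h]. The second moment
    has to be [1 + O(h^2)] without a linear term: the linear term cancels because [f] and its
    translate both have mass 1. The level 4 is the square of 2: for [a = sqrt (f (z - h))] and
    [b = sqrt (f z)] the test reads [a <= 2 b], which makes the comparisons with [(a - b)^2]
    elementary. The constant [M] is fixed before [n] grows, so that the probability under 0,
    multiplied by [M], still becomes small. *)

(** * Integrals determined by their values on indicators *)

Section transport.
Context (R : realType) (dY : measure_display) (Y : measurableType dY).

(** The simple functions depend on [u] alone, not on [m], [X] or [w]. Hence two such expansions
    agree termwise as soon as the integrals against indicators agree. *)
Lemma ge0_integral_weight_lim d (T : measurableType d)
    (m : {measure set T -> \bar R}) (X : T -> Y) (w : T -> R) (u : Y -> R)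
    (mEu : measurable_fun setT (EFin \o u)) :
  measurable_fun setT X -> measurable_fun setT w -> (forall z, 0 <= w z) ->
  (forall y, 0 <= u y) ->
  (\int[m]_z (w z * u (X z))%:E =
   limn (fun n => \sum_(r \in range (nnsfun_approx measurableT mEu n))
     (r%:E * \int[m]_z (w z *
        \1_(nnsfun_approx measurableT mEu n @^-1` [set r]) (X z))%:E)))%E.
Proof.
move=> mX mw w0 u0.
set g := nnsfun_approx measurableT mEu.
have mind r n : measurable_fun setT
    (fun z : T => (w z * \1_(g n @^-1` [set r]) (X z))%:E).
  apply/measurable_EFinP; apply: measurable_funM => //.
  by apply: (measurableT_comp _ mX); exact: measurable_indic.
transitivity (limn (fun n => \int[m]_z (w z * g n (X z))%:E))%E; last first.
  congr (limn _); apply/funext => n.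
  transitivity (\int[m]_z (\sum_(r \in range (g n))
      (r%:E * (w z * \1_(g n @^-1` [set r]) (X z))%:E)))%E.
    apply: eq_integral => z _.
    rewrite fimfunE EFinM -fsumEFin//.
    rewrite ge0_mule_fsumr; last first.
      (* A value [r] outside the range may be negative, but its preimage is empty and the term is
         0. *)
      move=> r; have [/= [y _ <-]|nr] := pselect (range (g n) r).
        by rewrite lee_fin mulr_ge0.
      by rewrite preimage10 // indic0 mulr0.
    by apply: eq_fsbigr => r _; rewrite -!EFinM mulrCA.
  rewrite ge0_integral_fsum//.
  - apply: eq_fsbigr => r; rewrite inE => -[y _ <-].
    by rewrite ge0_integralZl ?lee_fin// => z _; rewrite lee_fin mulr_ge0.
  - by move=> r; apply: emeasurable_funM => //; exact: measurable_cst.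
  - move=> r z _; have [/= [y _ <-]|nr] := pselect (range (g n) r).
      by rewrite -EFinM lee_fin !mulr_ge0.
    by rewrite preimage10 // indic0 !mulr0 mule0.
rewrite -monotone_convergence//.
- apply: eq_integral => z _; apply/esym/cvg_lim => //.
  under eq_fun do rewrite EFinM.
  rewrite EFinM; apply: cvgeZl => //.
  by apply: (cvg_nnsfun_approx measurableT mEu) => // y _; rewrite lee_fin.
- move=> n; apply/measurable_EFinP; apply: measurable_funM => //.
  exact: (measurableT_comp _ mX).
- by move=> n z _; rewrite lee_fin mulr_ge0.
- move=> z _ n1 n2 n12; rewrite lee_fin ler_wpM2l//.
  exact/lefP/nd_nnsfun_approx.
Qed.

Lemma ge0_integral_transport d1 (T1 : measurableType d1) d2
    (T2 : measurableType d2) (m1 : {measure set T1 -> \bar R})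
    (m2 : {measure set T2 -> \bar R}) (X1 : T1 -> Y) (X2 : T2 -> Y)
    (w1 : T1 -> R) (w2 : T2 -> R) (u : Y -> R) :
  measurable_fun setT X1 -> measurable_fun setT X2 ->
  measurable_fun setT w1 -> measurable_fun setT w2 ->
  (forall z, 0 <= w1 z) -> (forall z, 0 <= w2 z) ->
  (forall A, measurable A ->
    \int[m1]_z (w1 z * \1_A (X1 z))%:E =
    \int[m2]_z (w2 z * \1_A (X2 z))%:E)%E ->
  measurable_fun setT u -> (forall y, 0 <= u y) ->
  (\int[m1]_z (w1 z * u (X1 z))%:E = \int[m2]_z (w2 z * u (X2 z))%:E)%E.
Proof.
move=> mX1 mX2 mw1 mw2 w10 w20 H /measurable_EFinP mu u0.
rewrite (ge0_integral_weight_lim m1 mu)// (ge0_integral_weight_lim m2 mu)//.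
by congr (limn _); apply/funext => n; apply: eq_fsbigr => r _; rewrite H.
Qed.
End transport.

(** * Product formula for expectations of bounded functions of independent errors *)

Section independence.
Context (R : realType) (d : measure_display) (T : measurableType d).
Context (P : probability T R) (eps : nat -> {RV P >-> R}).
Hypothesis eps_indep : mutually_independent P eps.

Lemma integral_bounded_fin (Y : T -> R) (K : R) :
  measurable_fun setT Y -> (forall w, 0 <= Y w <= K) ->
  (\int[P]_w (Y w)%:E)%E \is a fin_num.
Proof.
move=> mY Y01; rewrite ge0_fin_numE; last first.
  by apply: integral_ge0 => w _; rewrite lee_fin; case/andP: (Y01 w).
apply: (@le_lt_trans _ _ (\int[P]_w K%:E)%E).
  apply: ge0_le_integral => //.
  - by move=> w _; rewrite lee_fin; case/andP: (Y01 w).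
  - exact/measurable_EFinP.
  - by move=> w _; rewrite lee_fin; case/andP: (Y01 w).
rewrite integral_cst//= [X in (_ * X)%E]probability_setT mule1 ltry //.
Qed.

Lemma measurable_prod_RV (s : seq nat) (v : nat -> R -> R) :
  (forall t, measurable_fun setT (v t)) ->
  measurable_fun setT (fun w : T => \prod_(t <- s) v t (eps t w)).
Proof.
move=> mv; apply: measurable_prod => t _.
by apply: (measurableT_comp (mv t)); exact: measurable_funPT.
Qed.

Lemma indicator_integral_prod (s : seq nat) (A : nat -> set R) : uniq s ->
  (forall t, measurable (A t)) ->
  (\int[P]_w (\prod_(t <- s) \1_(A t) (eps t w))%:E =
   \prod_(t <- s) \int[P]_w (\1_(A t) (eps t w))%:E)%E.
Proof.
move=> us mA; have mX t : measurable (eps t @^-1` A t).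
  by rewrite -[X in measurable X]setTI; exact: measurable_funPT.
transitivity (\prod_(t <- s) P (eps t @^-1` A t))%E; last first.
  apply: eq_bigr => t _; rewrite -[RHS]/(\int[P]_w (\1_(eps t @^-1` A t) w)%:E)%E.
  by rewrite integral_indic// setIT.
have sJ : perm_eq s (enum_fset [fset t in s]%fset).
  apply: uniq_perm; [exact: us|exact: fset_uniq|].
  by move=> t; rewrite -[RHS]/(t \in [fset t in s]%fset) !inE.
rewrite [RHS](perm_big _ sJ)/= -eps_indep//.
set B := \bigcap_(t in _) _.
have mB : measurable B.
  by apply: fin_bigcap_measurable => // t _.
rewrite -[B]setIT -integral_indic//; apply: eq_integral => w _; congr EFin.
rewrite [RHS]indicE; have [wB|wB] := boolP (w \in B).
  apply: big1_seq => t /andP[_ ts]; rewrite indicE mem_set//.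
  by move: wB; rewrite inE => /(_ t); apply; rewrite /= inE.
apply/eqP; rewrite prodf_seq_eq0; apply/hasP.
move: wB; rewrite notin_setE => /existsNP[t] /not_implyP[/=].
rewrite inE => ts /= nA; exists t => //=.
by rewrite indicE memNset// eqxx.
Qed.

Lemma bounded_integral_prod (s : seq nat) (v : nat -> R -> R) (K : R) : uniq s ->
  (forall t, measurable_fun setT (v t)) -> (forall t z, 0 <= v t z <= K) ->
  (\int[P]_w (\prod_(t <- s) v t (eps t w))%:E =
   \prod_(t <- s) \int[P]_w (v t (eps t w))%:E)%E.
Proof.
move=> us mv vK.
(* One factor after the other is turned from an indicator into a function. *)
suff H (l : seq nat) (v' : nat -> R -> R) : (forall t, measurable_fun setT (v' t)) ->
    (forall t z, 0 <= v' t z <= Num.max K 1) ->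
    (forall t, t \notin l -> exists2 A, measurable A & v' t = \1_A) ->
  (\int[P]_w (\prod_(t <- s) v' t (eps t w))%:E =
   \prod_(t <- s) \int[P]_w (v' t (eps t w))%:E)%E.
  (* Factors outside [s] do not occur in the products and are reset to the constant 1, an indicator,
     so that [s] itself can serve as [l]. Indicators also have to obey the common bound, whence
     [Num.max K 1]. *)
  have := H s (fun t => if t \in s then v t else \1_setT).
  rewrite (eq_big_seq (fun t => \int[P]_w (v t (eps t w))%:E)%E); last first.
    by move=> t ->.
  move=> <-.
  - apply: eq_integral => w _; congr EFin.
    by apply: eq_big_seq => t ->.
  - by move=> t; case: ifP => // _; exact: measurable_indic.
  - move=> t z; case: ifP => [_|_]; last by rewrite indicT ler01 le_max lexx orbT.
    by case/andP: (vK t z) => -> /= h; rewrite le_max h.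
  - by move=> t /negbTE ->; exists setT.
elim: l v' => [|j l IH] {mv vK}{}v mv vK vl.
  have vA t : exists A, measurable A /\ v t = \1_A.
    by have [A mA vA] := vl t isT; exists A.
  have {vA}[A vA] := choice vA.
  under eq_integral do under eq_bigr do rewrite (vA _).2.
  rewrite indicator_integral_prod//; last by move=> t; case: (vA t).
  by apply: eq_bigr => t _; rewrite (vA _).2.
pose vj A t := if t == j then \1_A else v t.
have mvj A t : measurable A -> measurable_fun setT (vj A t).
  by rewrite /vj; case: ifP => // _ mA; exact: measurable_indic.
have vjK A t z : 0 <= vj A t z <= Num.max K 1.
  rewrite /vj; case: ifP => // _.
  by rewrite indicE; case: (_ \in _); rewrite /= ?lexx ?ler01 le_max ?ler01 ?lexx orbT.
have IHj A : measurable A ->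
  (\int[P]_w (\prod_(t <- s) vj A t (eps t w))%:E =
   \prod_(t <- s) \int[P]_w (vj A t (eps t w))%:E)%E.
  move=> mA; apply: IH => // [t|t tl]; first exact: mvj.
  rewrite /vj; case: ifPn => [_|tj]; first by exists A.
  by apply: vl; rewrite inE negb_or tj.
have [js|js] := boolP (j \in s); last first.
  have vj_s t : t \in s -> vj setT t = v t.
    by rewrite /vj; case: eqVneq => // ->; rewrite (negbTE js).
  transitivity (\prod_(t <- s) \int[P]_w (vj setT t (eps t w))%:E)%E; last first.
    by apply: eq_big_seq => t /vj_s ->.
  rewrite -IHj//; apply: eq_integral => w _; congr EFin.
  by apply: eq_big_seq => t /vj_s ->.
rewrite (bigD1_seq j)//= -big_filter.
set s' := [seq i <- s | i != j].
under eq_integral do rewrite (bigD1_seq j)//= -big_filter mulrC.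
have fE : (\prod_(i <- s') \int[P]_w (v i (eps i w))%:E)%E \is a fin_num.
  rewrite big_seq; apply: prode_fin_num => t _.
  apply: (@integral_bounded_fin _ (Num.max K 1)) => //.
  by apply: (measurableT_comp (mv t)); exact: measurable_funPT.
pose c := fine (\prod_(i <- s') \int[P]_w (v i (eps i w))%:E)%E.
have c0 : 0 <= c.
  apply: fine_ge0; apply: prode_ge0 => t _; apply: integral_ge0 => w _.
  by rewrite lee_fin; case/andP: (vK t (eps t w)).
(* The product of the other factors plays the role of a weight. By [IHj] it can be replaced by its
   mean [c] against every indicator of [eps j], hence also against [v j]. *)
rewrite (@ge0_integral_transport _ _ _ _ _ _ _ P P (eps j) (eps j) _ (cst c) (v j)).
- rewrite muleC -(fineK fE) -/c -ge0_integralZl//.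
  + apply/measurable_EFinP/measurableT_comp => //; exact: measurable_funPT.
  + by move=> w _; rewrite lee_fin; case/andP: (vK j (eps j w)).
- exact: measurable_funPT.
- exact: measurable_funPT.
- exact: measurable_prod_RV.
- exact: measurable_cst.
- by move=> w; apply: prodr_ge0 => t _; case/andP: (vK t (eps t w)).
- by [].
- move=> A mA; have := IHj A mA.
  rewrite (bigD1_seq j)//= -big_filter -/s'.
  under eq_integral do rewrite (bigD1_seq j)//= -big_filter mulrC.
  have vj_s' t : t \in s' -> vj A t = v t.
    by rewrite mem_filter /vj => /andP[/negbTE ->].
  rewrite (eq_big_seq (fun i => \int[P]_w (v i (eps i w))%:E)%E); last first.
    by move=> t /vj_s' ->.
  under eq_integral => w _.
    rewrite (eq_big_seq (fun i => v i (eps i w))); last by move=> t /vj_s' ->.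
    over.
  rewrite {1 2}/vj eqxx => ->.
  rewrite muleC -(fineK fE) -/c -ge0_integralZl//.
  apply/measurable_EFinP/measurableT_comp; first exact: measurable_indic.
  exact: measurable_funPT.
- exact: mv.
- by move=> y; case/andP: (vK j y).
Qed.

End independence.

(** * Weighted laws of samples, compared on rectangles *)

Section tuple_law.
Context (R : realType).

Definition rectangle n : set (set (n.-tuple R)) :=
  [set B | exists2 A : nat -> set R, (forall t, measurable (A t)) &
     B = [set y | forall i : 'I_n, A i (tnth y i)]].

Lemma setI_closed_rectangle n : setI_closed (@rectangle n).
Proof.
move=> _ _ [A mA ->] [B mB ->]; exists (fun t => A t `&` B t).
  by move=> t; exact: measurableI.
by apply/seteqP; split => y /= => [[yA yB] i|yAB]; [split|split => i; case: (yAB i)].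
Qed.

Lemma measurable_rectangle n : measurable = <<s @rectangle n >>.
Proof.
apply/seteqP; split; last first.
  apply: smallest_sub; first exact: sigma_algebra_measurable.
  move=> _ [A mA ->].
  rewrite (_ : mkset _ = \bigcap_(i in [set: 'I_n]) ((@tnth _ R ^~ i) @^-1` A i)); last first.
    by apply/seteqP; split => y /= => [yA i _|yA i]; exact: yA.
  apply: fin_bigcap_measurable; first exact: finite_finset.
  move=> i _; rewrite -[X in measurable X]setTI.
  exact: measurable_tnth.
apply: smallest_sub; first exact: smallest_sigma_algebra.
rewrite -bigcup_seq => _ [i _] [A mA <-]; apply: sub_sigma_algebra.
(* A cylinder is a rectangle all of whose other sides are full. *)
exists (fun t : nat => if t == i :> nat then A else setT).
  by move=> t; case: ifP.
apply/seteqP; split => y /=.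
  by move=> [_ yA] j; case: ifP => // /eqP/val_inj ->.
by move=> /(_ i); rewrite eqxx.
Qed.

Context (d : measure_display) (T : measurableType d).
Context (P : probability T R) (eps : nat -> {RV P >-> R}).
Hypothesis eps_indep : mutually_independent P eps.

Lemma measurable_tuple_RV n (g : nat -> R -> R) :
  (forall t, measurable_fun setT (g t)) ->
  measurable_fun setT (fun w : T => [tuple g t (eps t w) | t < n]).
Proof.
move=> mg; apply/measurable_fun_tnthP => i.
rewrite (_ : _ \o _ = g i \o eps i); last first.
  by apply/funext => w /=; rewrite tnth_mktuple.
by apply: measurableT_comp => //; exact: measurable_funPT.
Qed.

(** As functions of [B], both sides are finite measures that factorize on rectangles by
    independence, so equality of the one-dimensional factors suffices. In the application one side
    is the shifted sample restricted to moderate ratios, the other the unshifted sample weighted by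
    its likelihood ratio. *)
Lemma weighted_tuple_law_eq n (g1 g2 v1 v2 : nat -> R -> R) (K : R)
    (B : set (n.-tuple R)) :
  (forall t, measurable_fun setT (g1 t)) ->
  (forall t, measurable_fun setT (g2 t)) ->
  (forall t, measurable_fun setT (v1 t)) ->
  (forall t, measurable_fun setT (v2 t)) ->
  (forall t z, 0 <= v1 t z <= K) -> (forall t z, 0 <= v2 t z <= K) ->
  (forall t A, measurable A ->
    \int[P]_w (v1 t (eps t w) * \1_A (g1 t (eps t w)))%:E =
    \int[P]_w (v2 t (eps t w) * \1_A (g2 t (eps t w)))%:E)%E ->
  measurable B ->
  (\int[P]_(w in (fun w => [tuple g1 t (eps t w) | t < n]) @^-1` B)
      (\prod_(0 <= t < n) v1 t (eps t w))%:E =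
   \int[P]_(w in (fun w => [tuple g2 t (eps t w) | t < n]) @^-1` B)
      (\prod_(0 <= t < n) v2 t (eps t w))%:E)%E.
Proof.
move=> mg1 mg2 mv1 mv2 v1K v2K v12.
have mX (g : nat -> R -> R) (C : set (n.-tuple R)) : (forall t, measurable_fun setT (g t)) ->
    measurable C -> measurable ((fun w => [tuple g t (eps t w) | t < n]) @^-1` C).
  move=> mg mC; rewrite -[X in measurable X]setTI.
  exact: (measurable_tuple_RV mg measurableT mC).
have w0 (v : nat -> R -> R) w : (forall t z, 0 <= v t z <= K) ->
    (0 <= (\prod_(0 <= t < n) v t (eps t w))%:E)%E.
  by move=> vK; rewrite lee_fin prodr_ge0// => t _; case/andP: (vK t (eps t w)).
have mw (v : nat -> R -> R) S : (forall t, measurable_fun setT (v t)) ->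
    measurable_fun S (fun w => (\prod_(0 <= t < n) v t (eps t w))%:E).
  move=> mv; apply: (measurable_funS measurableT) => //.
  by apply/measurable_EFinP; exact: measurable_prod_RV.
have rect (g v : nat -> R -> R) (A : nat -> set R) : (forall t, measurable_fun setT (g t)) ->
    (forall t, measurable_fun setT (v t)) -> (forall t z, 0 <= v t z <= K) ->
    (forall t, measurable (A t)) ->
  (\int[P]_(w in (fun w => [tuple g t (eps t w) | t < n]) @^-1`
          [set y | forall i : 'I_n, A i (tnth y i)])
      (\prod_(0 <= t < n) v t (eps t w))%:E =
   \prod_(0 <= t < n) \int[P]_w (v t (eps t w) * \1_(A t) (g t (eps t w)))%:E)%E.
  move=> mg mv vK mA.
  rewrite -(@bounded_integral_prod _ _ _ _ _ eps_indep _
    (fun t z => v t z * \1_(A t) (g t z)) K); last first.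
  - move=> t z; case/andP: (vK t z) => v0 vK'.
    rewrite indicE; case: (_ \in _); rewrite ?mulr1 ?mulr0 ?v0//= lexx.
    exact: le_trans vK'.
  - move=> t; apply: measurable_funM => //.
    by apply: measurableT_comp => //; exact: measurable_indic.
  - exact: iota_uniq.
  rewrite integral_mkcond; apply: eq_integral => w _.
  rewrite patchE; case: ifPn => [|wA].
    rewrite inE /= => wA; congr EFin; rewrite !big_mkord; apply: eq_bigr => i _.
    by have := wA i; rewrite tnth_mktuple indicE => /mem_set ->; rewrite mulr1.
  apply/esym; congr EFin; apply/eqP; rewrite big_mkord prodf_seq_eq0; apply/hasP.
  move: wA; rewrite notin_setE => /existsNP[i]; rewrite tnth_mktuple => nA.
  by exists i; rewrite ?mem_index_enum//= indicE memNset// mulr0.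
(* Finite total mass is what allows subtraction in the complement step of the Dynkin induction. *)
have allT (g v : nat -> R -> R) : (forall t, measurable_fun setT (g t)) ->
    (forall t, measurable_fun setT (v t)) -> (forall t z, 0 <= v t z <= K) ->
    (\int[P]_w (\prod_(0 <= t < n) v t (eps t w))%:E)%E \is a fin_num.
  move=> mg mv vK; apply: (@integral_bounded_fin _ _ _ _ _ (K ^+ n)).
    exact: measurable_prod_RV.
  move=> w; rewrite -lee_fin w0//= -[X in _ <= _ ^+ X](subn0 n) -prodr_const_nat.
  by apply: ler_prod => t _; exact: vK.
have T12 : (\int[P]_w (\prod_(0 <= t < n) v1 t (eps t w))%:E =
    \int[P]_w (\prod_(0 <= t < n) v2 t (eps t w))%:E)%E.
  have := rect g1 v1 (fun=> setT) mg1 mv1 v1K (fun=> measurableT).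
  under eq_bigr do rewrite v12//.
  rewrite -(rect g2 v2 (fun=> setT))//.
  rewrite (_ : [set y | _] = setT)// -subTset => y _ i //.
rewrite {1}measurable_rectangle.
pose same (C : set (n.-tuple R)) :=
  (\int[P]_(w in (fun w => [tuple g1 t (eps t w) | t < n]) @^-1` C)
      (\prod_(0 <= t < n) v1 t (eps t w))%:E =
   \int[P]_(w in (fun w => [tuple g2 t (eps t w) | t < n]) @^-1` C)
      (\prod_(0 <= t < n) v2 t (eps t w))%:E)%E.
rewrite -/(same B); move: B.
apply: (dynkin_induction (@measurable_rectangle n) (@setI_closed_rectangle n)).
- by rewrite /same !preimage_setT T12.
- move=> _ [A mA ->]; rewrite /same !rect//.
  by apply: eq_bigr => t _; exact: v12.
- rewrite /same => S mS IH.
  have cplt (g v : nat -> R -> R) : (forall t, measurable_fun setT (g t)) ->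
    (forall t, measurable_fun setT (v t)) -> (forall t z, 0 <= v t z <= K) ->
    (\int[P]_w (\prod_(0 <= t < n) v t (eps t w))%:E =
     \int[P]_(w in (fun w => [tuple g t (eps t w) | t < n]) @^-1` S)
      (\prod_(0 <= t < n) v t (eps t w))%:E +
     \int[P]_(w in (fun w => [tuple g t (eps t w) | t < n]) @^-1` (~` S))
      (\prod_(0 <= t < n) v t (eps t w))%:E)%E.
    move=> mg mv vK; rewrite -ge0_integral_setU//.
    + by rewrite -preimage_setU setUv preimage_setT.
    + exact: mX.
    + by apply: mX => //; exact: measurableC.
    + exact: mw.
    + by move=> w _; exact: w0.
    + by apply/disj_setPS; rewrite -preimage_setI setICr preimage_set0.
  have c1 := cplt _ _ mg1 mv1 v1K.
  have c2 := cplt _ _ mg2 mv2 v2K.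
  have f1 := allT _ _ mg1 mv1 v1K.
  move: T12; rewrite c1 c2 IH; rewrite c1 fin_numD in f1; case/andP: f1 => f1 f2.
  rewrite -IH [LHS]addeC [RHS]addeC => e12.
  by rewrite -[LHS](addeK _ f1) e12 addeK.
- rewrite /same => F mF tF IH; rewrite !preimage_bigcup.
  rewrite !ge0_integral_bigcup//.
  + by apply: eq_eseriesr => i _; exact: IH.
  + by move=> i; exact: mX.
  + exact: mw.
  + by move=> w _; exact: w0.
  + by move=> i j _ _ [w [Fi Fj]]; apply: tF => //; eexists; split; [exact: Fi|].
  + by move=> i; exact: mX.
  + exact: mw.
  + by move=> w _; exact: w0.
  + by move=> i j _ _ [w [Fi Fj]]; apply: tF => //; eexists; split; [exact: Fi|].
Qed.

End tuple_law.

(** * Change of measure with a truncated likelihood ratio *)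

Section truncated_second_moment.
Context (R : realType) (d : measure_display) (T : measurableType d).
Context (P : probability T R) (eps : nat -> {RV P >-> R}).
Hypothesis eps_indep : mutually_independent P eps.

(* [D t] is the set of values of the error at which the likelihood ratio
   exceeds the truncation level; off [D t], the density of the shifted error
   with respect to the unshifted one is [L t]. *)
Lemma shifted_sample_le n (h : nat -> R) (D : nat -> set R)
    (L : nat -> R -> R) (K M : R) (B : set (n.-tuple R)) :
  (forall t, measurable (D t)) ->
  (forall t, measurable_fun setT (L t)) -> (forall t z, 0 <= L t z <= K) ->
  (forall t A, measurable A ->
    \int[P]_w (\1_(~` D t) (eps t w) * \1_A (h t + eps t w))%:E =
    \int[P]_w (L t (eps t w) * \1_A (eps t w))%:E)%E ->
  measurable B -> 0 < M ->
  (P ((fun w => [tuple (h t + eps t w)%R | t < n]) @^-1` B) <=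
   \sum_(0 <= t < n) P (eps t @^-1` D t) +
   (M%:E * P ((fun w => [tuple eps t w | t < n]) @^-1` B) +
    M^-1%:E * \prod_(0 <= t < n) \int[P]_w (L t (eps t w) ^+ 2)%:E))%E.
Proof.
move=> mD mL LK DL mB M0.
pose v t : R -> R := \1_(~` D t).
pose K' := Num.max K 1.
have mv t : measurable_fun setT (v t).
  by apply: measurable_indic; exact: measurableC.
have vK t z : 0 <= v t z <= K'.
  by rewrite /v indicE; case: (_ \in _); rewrite /= ?lexx ?ler01 /K' le_max ?ler01 ?lexx orbT.
have LK' t z : 0 <= L t z <= K'.
  by case/andP: (LK t z) => -> h'; rewrite le_max h'.
have mid t : measurable_fun setT (fun z : R => h t + z) by exact: measurable_funD.
have mid' (t : nat) : measurable_fun setT (@id R) by exact: measurable_id.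
have law := @weighted_tuple_law_eq _ _ _ _ _ eps_indep n
  (fun t z => h t + z) (fun=> id) v L K' B mid mid' mv mL vK LK' DL mB.
have mX (g : nat -> R -> R) : (forall t, measurable_fun setT (g t)) ->
    measurable ((fun w => [tuple g t (eps t w) | t < n]) @^-1` B).
  move=> mg; rewrite -[X in measurable X]setTI.
  exact: (measurable_tuple_RV eps mg measurableT mB).
have mS := mX _ mid.
have mE := mX _ mid'.
set S := (fun w => [tuple h t + eps t w | t < n]) @^-1` B.
set E := (fun w => [tuple eps t w | t < n]) @^-1` B.
have mprod (u : nat -> R -> R) : (forall t, measurable_fun setT (u t)) ->
    measurable_fun setT (fun w => \prod_(0 <= t < n) u t (eps t w)).
  exact: measurable_prod_RV.
have mXD t : measurable (eps t @^-1` D t).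
  by rewrite -[X in measurable X]setTI; exact: measurable_funPT.
have mDE t : measurable_fun setT (fun w => (\1_(D t) (eps t w))%:E : \bar R).
  apply/measurable_EFinP; apply: measurableT_comp; last exact: measurable_funPT.
  exact: measurable_indic.
have vprod0 w : 0 <= \prod_(0 <= t < n) v t (eps t w).
  by rewrite prodr_ge0// => t _; case/andP: (vK t (eps t w)).
apply: (@le_trans _ _ (\int[P]_(w in S) (\prod_(0 <= t < n) v t (eps t w))%:E +
    \sum_(0 <= t < n) P (eps t @^-1` D t)))%E.
  have PS : (P S = \int[P]_(w in S) 1)%E by rewrite integral_cst// mul1e.
  have -> : (\sum_(0 <= t < n) P (eps t @^-1` D t) =
      \int[P]_w \sum_(0 <= t < n) (\1_(D t) (eps t w))%:E)%E.
    rewrite ge0_integral_sum//; apply: eq_bigr => t _.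
    rewrite -[RHS]/(\int[P]_w (\1_(eps t @^-1` D t) w)%:E)%E.
    by rewrite integral_indic// setIT.
  have msum : measurable_fun setT
      (fun w => \sum_(0 <= t < n) (\1_(D t) (eps t w) : R)%:E)%E.
    exact: (emeasurable_sum (index_iota 0 n) mDE).
  apply: (@le_trans _ _ (\int[P]_(w in S) (\prod_(0 <= t < n) v t (eps t w))%:E +
      \int[P]_(w in S) \sum_(0 <= t < n) (\1_(D t) (eps t w))%:E))%E; last first.
    apply: leeD => //; apply: ge0_subset_integral => //.
    by move=> w _; apply: sume_ge0 => t _; rewrite lee_fin.
  rewrite -ge0_integralD//; first last.
  - exact: (measurable_funS measurableT).
  - by move=> w _; apply: sume_ge0 => t _; rewrite lee_fin.
  - by apply: (measurable_funS measurableT) => //; apply/measurable_EFinP; exact: mprod.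
  - by move=> w _; rewrite lee_fin.
  rewrite PS; apply: ge0_le_integral => //.
  - apply: (measurable_funS measurableT) => //; apply: emeasurable_funD => //.
    by apply/measurable_EFinP; exact: mprod.
  move=> w _; rewrite sumEFin -EFinD lee_fin.
  (* Either some error lies in its [D t], and the sum of indicators is at least 1, or all errors
     avoid these sets, and the product of the [v t] is 1. *)
  have [wD|] := pselect (exists2 t, (t < n)%N & D t (eps t w)).
    case: wD => t tn Dt; rewrite -[leLHS]add0r lerD// (bigD1_seq t) ?iota_uniq//=.
      by rewrite indicE mem_set// lerDl sumr_ge0.
    by rewrite mem_index_iota.
  move=> nD; rewrite big1_seq ?lerDl ?sumr_ge0// => t /andP[_].
  rewrite mem_index_iota => /andP[_ tn]; rewrite /v indicE mem_set//= => Dt.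
  by apply: nD; exists t.
rewrite addeC leeD//.
pose Lam w := \prod_(0 <= t < n) L t (eps t w).
have Lam0 w : 0 <= Lam w by rewrite prodr_ge0// => t _; case/andP: (LK t (eps t w)).
have mLam : measurable_fun setT Lam by exact: mprod.
(* The shifted sample is exchanged for the unshifted one at the price of the weight [Lam]. *)
rewrite [leLHS]law -/E.
have -> : (\prod_(0 <= t < n) \int[P]_w (L t (eps t w) ^+ 2)%:E =
    \int[P]_w (Lam w ^+ 2)%:E)%E.
  rewrite -(@bounded_integral_prod _ _ _ _ _ eps_indep _
    (fun t z => L t z ^+ 2) (K' ^+ 2)); last first.
  - move=> t z; case/andP: (LK' t z) => L0 LK''.
    by rewrite sqr_ge0 lerXn2r// ?nnegrE// (le_trans L0).
  - by move=> t; exact: measurable_funX.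
  - exact: iota_uniq.
  by apply: eq_integral => w _; rewrite prodrXl.
have -> : (M%:E * P E = \int[P]_(w in E) M%:E)%E by rewrite integral_cst.
apply: (@le_trans _ _ (\int[P]_(w in E) M%:E +
    \int[P]_(w in E) (M^-1 * Lam w ^+ 2)%:E))%E; last first.
  have mLam2 : measurable_fun setT (fun w => (Lam w ^+ 2)%:E).
    by apply/measurable_EFinP; exact: measurable_funX.
  have iM0 : 0 <= M^-1 by rewrite invr_ge0 ltW.
  have L20 w : (0 <= (Lam w ^+ 2)%:E)%E by rewrite lee_fin sqr_ge0.
  rewrite leeD2l// -ge0_integralZl_EFin//.
  under [leRHS]eq_integral do rewrite -EFinM.
  apply: ge0_subset_integral => //.
    by apply/measurable_EFinP; apply: measurable_funM => //; exact: measurable_funX.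
  by move=> w _; rewrite lee_fin mulr_ge0// sqr_ge0.
have mLM : measurable_fun E (fun w => (M^-1 * Lam w ^+ 2)%:E).
  apply: (measurable_funS measurableT) => //.
  apply/measurable_EFinP; apply: measurable_funM => //; exact: measurable_funX.
have LM0 w : (0 <= (M^-1 * Lam w ^+ 2)%:E)%E.
  by rewrite lee_fin mulr_ge0 ?sqr_ge0// invr_ge0 ltW.
rewrite -ge0_integralD//; last by move=> w _; rewrite lee_fin ltW.
apply: ge0_le_integral => //.
- by move=> w _; rewrite lee_fin; exact: Lam0.
- by apply: (measurable_funS measurableT) => //; apply/measurable_EFinP.
- by apply: emeasurable_funD.
move=> w _; rewrite -EFinD lee_fin -/(Lam w).
(* Pointwise [Lam <= M + Lam^2 / M]: if [Lam > M], then already [Lam <= Lam * (Lam / M)]. *)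
have [LM|ML] := leP (Lam w) M.
  by rewrite (le_trans LM)// lerDl mulr_ge0 ?sqr_ge0// invr_ge0 ltW.
apply: (@le_trans _ _ (M^-1 * Lam w ^+ 2)); last by rewrite lerDr ltW.
by rewrite expr2 mulrA ler_peMl// ler_pdivlMl// mulr1 ltW.
Qed.

End truncated_second_moment.

(** * Increments of the square root of the density, bounded by Fisher information *)

Section fisher_increment.
Context (R : realType).
Notation mu := (@lebesgue_measure R).

(** A family consisting of one interval suffices; [z - 1] and [z + 1] merely provide a compact
    interval around [z]. The resulting continuity of [derive1 f] feeds the fundamental theorem of
    calculus below. *)
Lemma absolutely_continuous_continuous (g : R -> R) :
  absolutely_continuous g -> continuous g.
Proof.
move=> acg z; apply/cvgrPdist_lt => e e0.
have [dl dl0 H] := acg (z - 1) (z + 1) e e0.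
near=> y.
have yz : `|z - y| < Num.min 1 dl.
  by near: y; apply: cvgr_dist_lt => //; rewrite lt_min ltr01.
move: yz; rewrite lt_min => /andP[yz1 yzd].
have step (a b : R) : z - 1 <= a -> a <= b -> b <= z + 1 -> b - a < dl ->
    `|g b - g a| < e.
  move=> za ab bz bad; have := H 1%N (fun=> a) (fun=> b).
  rewrite !big_ord1; apply => //.
  by move=> i j /= + + _; rewrite /= !ltnS !leqn0 => /eqP -> /eqP ->.
rewrite ltr_distl in yz1; rewrite ltr_distl in yzd.
have /andP[h1 h2] := yz1; have /andP[h3 h4] := yzd.
have [yz|zy] := leP y z; first by apply: step; lra.
by rewrite distrC; apply: step; lra.
Unshelve. all: by end_near. Qed.

(* [0 <= (G' - m)^2] with [m] the mean slope of [G] on [[a, b]]. *)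
Lemma sqr_increment_le (G G' : R -> R) (a b : R) : a < b ->
  (forall z : R, is_derive z 1 G (G' z)) -> continuous G' ->
  (((G b - G a) ^+ 2)%:E <= (b - a)%:E * \int[mu]_(y in `[a, b]) (G' y ^+ 2)%:E)%E.
Proof.
move=> ab dG cG'; have ba0 : 0 < b - a by rewrite subr_gt0.
pose m := (G b - G a) / (b - a).
(* [F] is a primitive of [G'^2 - (G' - m)^2], which is linear in [G']. Its increment equals
   [(G b - G a)^2 / (b - a)]. *)
pose F z := (2 * m) * G z - m ^+ 2 * z.
pose F' z := (2 * m) * G' z - m ^+ 2.
have dF (z : R) : is_derive z 1 F (F' z).
  have := dG z; move=> dGz; apply: is_derive_eq.
  by rewrite /F' [_%:A]mulr1.
have cF' : continuous F'.
  move=> z; apply: cvgB; last exact: cvg_cst.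
  by apply: cvgM; [exact: cvg_cst|exact: cG'].
have cF z : {for z, continuous F}.
  by apply/differentiable_continuous/derivable1_diffP; case: (dF z).
have FTC : (\int[mu]_(y in `[a, b]) (F' y)%:E = (F b)%:E - (F a)%:E)%E.
  apply: continuous_FTC2 => //.
  - exact: continuous_subspaceT.
  - split.
    + by move=> z _; case: (dF z).
    + by apply: cvg_at_right_filter; exact: cF.
    + by apply: cvg_at_left_filter; exact: cF.
  - by move=> z _; rewrite derive1E; apply: derive_val.
have cG2 : continuous (fun y => G' y ^+ 2).
  by move=> z; exact: (cvgM (cG' z) (cG' z)).
have le : (\int[mu]_(y in `[a, b]) (F' y)%:E <=
    \int[mu]_(y in `[a, b]) (G' y ^+ 2)%:E)%E.
  apply: le_integral => //.
  - apply: continuous_compact_integrable; first exact: segment_compact.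
    exact: continuous_subspaceT.
  - apply: continuous_compact_integrable; first exact: segment_compact.
    exact: continuous_subspaceT.
  - by move=> z _; rewrite lee_fin /F' -subr_ge0 opprB addrCA addrA
      (_ : _ - _ = (G' z - m) ^+ 2) ?sqr_ge0//; ring.
apply: le_trans (lee_wpmul2l _ le); last by rewrite lee_fin ltW.
rewrite FTC -EFinB -EFinM lee_fin.
have me : G b - G a = m * (b - a) by rewrite /m divfK// gt_eqF.
rewrite (_ : F b - F a = 2 * m * (G b - G a) - m ^+ 2 * (b - a)); last by rewrite /F; ring.
by rewrite me le_eqVlt; apply/orP; left; apply/eqP; ring.
Qed.

Context (f : R -> R).
Hypothesis f0 : forall z, 0 <= f z.
Hypothesis f_derivable : forall z : R, derivable f z 1.
Hypothesis f'_cont : continuous (derive1 f).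

Definition fisher_integrand z := (derive1 f z / f z) ^+ 2 * f z.

Lemma fisher_integrand_ge0 z : 0 <= fisher_integrand z.
Proof. by rewrite mulr_ge0// sqr_ge0. Qed.

Lemma measurable_inv_real : measurable_fun setT (@GRing.inv R).
Proof.
rewrite (_ : setT = [set 0] `|` ~` [set (0 : R)]); last by rewrite setUv.
apply/measurable_funU => //; first exact: measurableC.
split; first exact: measurable_fun_set1.
apply: open_continuous_measurable_fun.
  by apply: closed_openC; apply: accessible_closed_set1; exact: hausdorff_accessible.
move=> z; rewrite inE => /eqP z0.
exact: inv_continuous.
Qed.

Lemma density_continuous : continuous f.
Proof. by move=> z; apply/differentiable_continuous/derivable1_diffP. Qed.

Lemma measurable_fisher_integrand : measurable_fun setT fisher_integrand.
Proof.
have mf : measurable_fun setT f by apply: continuous_measurable_fun; exact: density_continuous.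
apply: measurable_funM => //; apply: measurable_funX; apply: measurable_funM.
  exact: continuous_measurable_fun.
by apply: measurableT_comp => //; exact: measurable_inv_real.
Qed.

(** Since [f] is nonnegative, each of its zeros is a minimum. *)
Lemma derive1_zero z : f z = 0 -> derive1 f z = 0.
Proof.
move=> fz0; rewrite derive1E; apply: derive_val.
apply: (@derive1_at_min _ f (z - 1) (z + 1)) => //.
- by lra.
- by rewrite in_itv/=; lra.
- by move=> t _; rewrite fz0.
Qed.

(** The square root of [f] may fail to be differentiable at zeros of [f]. The square root of
    [f + dl] is differentiable, with squared derivative [f'^2 / (4 (f + dl))], which is below the
    Fisher integrand also at zeros of [f], where [f'] vanishes too. Then [dl] tends to 0. *)
Lemma sqr_sqrt_increment_le (a b : R) : a < b ->
  (((Num.sqrt (f b) - Num.sqrt (f a)) ^+ 2)%:E <=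
   (b - a)%:E * \int[mu]_(y in `[a, b]) (fisher_integrand y)%:E)%E.
Proof.
move=> ab; have ba0 : 0 < b - a by rewrite subr_gt0.
have mphi D : measurable_fun D (fun y => (fisher_integrand y)%:E).
  apply: (measurable_funS measurableT) => //.
  by apply/measurable_EFinP; exact: measurable_fisher_integrand.
have shifted (dl : R) : 0 < dl ->
  (((Num.sqrt (f b + dl) - Num.sqrt (f a + dl)) ^+ 2)%:E <=
   (b - a)%:E * \int[mu]_(y in `[a, b]) (fisher_integrand y)%:E)%E.
  move=> dl0; have fd0 z : 0 < f z + dl by rewrite ltr_wpDl.
  pose G z := Num.sqrt (f z + dl).
  pose G' z := (2 * Num.sqrt (f z + dl))^-1 * derive1 f z.
  have dG (z : R) : is_derive z 1 G (G' z).
    apply: (@is_derive1_comp _ (@Num.sqrt R) (fun y => f y + dl)).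
      exact: is_derive1_sqrt.
    rewrite derive1E -[X in is_derive _ _ _ X]addr0.
    by apply: is_deriveD; exact: derivableP.
  have cG' : continuous G'.
    move=> z; apply: cvgM; last exact: f'_cont.
    apply: cvgV; first by rewrite mulf_neq0// gt_eqF// sqrtr_gt0.
    apply: cvgM; first exact: cvg_cst.
    apply: (@continuous_comp _ _ _ (fun y => f y + dl)); last exact: sqrt_continuous.
    by apply: cvgD; [exact: density_continuous|exact: cvg_cst].
  apply: le_trans (sqr_increment_le ab dG cG') _.
  apply: lee_wpmul2l; first by rewrite lee_fin ltW.
  apply: ge0_le_integral => //.
  - by move=> z _; rewrite lee_fin sqr_ge0.
  - apply: (measurable_funS measurableT) => //.
    apply/measurable_EFinP; apply: measurable_funX.
    exact: continuous_measurable_fun.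
  - exact: mphi.
  move=> z _; rewrite lee_fin /G' /fisher_integrand.
  rewrite !exprMn exprVn exprMn sqr_sqrtr; last exact/ltW.
  have [fz0|fz0] := eqVneq (f z) 0; first by rewrite derive1_zero// expr0n/= mulr0 !mul0r.
  have fz : 0 < f z by rewrite lt_neqAle eq_sym fz0 f0.
  rewrite [leLHS]mulrC -[leRHS]mulrA; apply: ler_wpM2l; first exact: sqr_ge0.
  rewrite (_ : (f z)^-1 ^+ 2 * f z = (f z)^-1); last by field.
  rewrite lef_pV2 ?posrE ?mulr_gt0//; have := fd0 z; nra.
(* The bound does not depend on [dl]. If it is finite, the limit is taken along [harmonic]; if it is
   infinite, the claim is trivial. *)
case: (\int[mu]_(y in `[a, b]) (fisher_integrand y)%:E)%E
  (integral_ge0 mu (D := `[a, b]%classic) (fun z _ =>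
    fisher_integrand_ge0 z : (0 <= (fisher_integrand z)%:E)%E))
  shifted => [J|_ _|//].
  rewrite !lee_fin => _ shifted.
  have c (x : R) : (fun n : nat => Num.sqrt (x + harmonic n) : R) @ \oo --> Num.sqrt x.
    apply: (@continuous_cvg _ _ _ _ _ (fun n => x + harmonic n) (@Num.sqrt R)).
      exact: sqrt_continuous.
    by rewrite -[X in _ --> X]addr0; apply: cvgD; [exact: cvg_cst|exact: cvg_harmonic].
  have C : (fun n : nat =>
      (Num.sqrt (f b + harmonic n) - Num.sqrt (f a + harmonic n)) ^+ 2) @ \oo
      --> (Num.sqrt (f b) - Num.sqrt (f a)) ^+ 2.
    under eq_fun do rewrite expr2.
    by rewrite expr2; apply: cvgM; exact: cvgB.
  rewrite -(cvg_lim _ C)//; apply: limr_le; first by apply/cvg_ex; eexists; exact: C.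
  by near=> n; have := shifted _ (harmonic_gt0 n).
by rewrite gt0_muley ?lte_fin// leey.
Unshelve. all: by end_near. Qed.

End fisher_increment.

(** * Hellinger-type distance between the density and its translates *)

Section shift_energy.
Context (R : realType).
Notation mu := (@lebesgue_measure R).
Context (f : R -> R).
Hypothesis f0 : forall z, 0 <= f z.
Hypothesis f_derivable : forall z : R, derivable f z 1.
Hypothesis f'_cont : continuous (derive1 f).

(** Integrated over the line, this is up to normalization the squared Hellinger distance between [f]
    and its translate. *)
Definition sqrt_shift_sq (h z : R) := (Num.sqrt (f (z + h)) - Num.sqrt (f z)) ^+ 2.

Lemma measurable_sqrt_shift_sq h : measurable_fun setT (sqrt_shift_sq h).
Proof.
have cf := density_continuous f_derivable.
have ms : measurable_fun setT (fun z => Num.sqrt (f z)).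
  apply: measurableT_comp; last exact: continuous_measurable_fun.
  by apply: continuous_measurable_fun; exact: sqrt_continuous.
apply: measurable_funX; apply: measurable_funB => //.
have mh : measurable_fun setT (fun z : R => z + h) by exact: measurable_funD.
exact: (measurableT_comp ms mh).
Qed.

Lemma measurable_band h (z : R) : measurable [set y : R | `|y - z| <= h].
Proof.
rewrite (_ : [set _ | _] = `[z - h, z + h]%classic); first exact: measurable_itv.
by apply/seteqP; split => y; rewrite /= in_itv/= ler_distl.
Qed.

(** The interval between [z] and [z + h] is enlarged to the band of radius [|h|] around [z]. This
    covers both signs of [h] and makes the relation between [y] and [z] symmetric, ready for
    exchanging integrals. *)
Lemma sqrt_shift_sq_le h z : ((sqrt_shift_sq h z)%:E <=
  `|h|%:E * \int[mu]_y (fisher_integrand f y * \1_[set y | `|y - z| <= `|h|] y)%:E)%E.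
Proof.
have mphi : measurable_fun setT (fisher_integrand f) by exact: measurable_fisher_integrand.
have sub (a b : R) : a < b -> (forall y, a <= y <= b -> `|y - z| <= `|h|) ->
    (((Num.sqrt (f b) - Num.sqrt (f a)) ^+ 2)%:E <= (b - a)%:E *
      \int[mu]_y (fisher_integrand f y * \1_[set y | `|y - z| <= `|h|] y)%:E)%E.
  move=> ab sub; apply: (le_trans (sqr_sqrt_increment_le f0 f_derivable f'_cont ab)).
  apply: lee_wpmul2l; first by rewrite lee_fin subr_ge0 ltW.
  rewrite integral_mkcond; apply: ge0_le_integral => //.
  - by move=> y _; rewrite patchE; case: ifP => // _; rewrite lee_fin fisher_integrand_ge0.
  - apply/(measurable_restrictT _ _).1 => //; apply: (measurable_funS measurableT) => //.
    exact/measurable_EFinP.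
  - apply/measurable_EFinP; apply: measurable_funM => //.
    by apply: measurable_indic; exact: measurable_band.
  move=> y _; rewrite patchE; case: ifPn => [|_].
    by rewrite inE /= in_itv/= indicE => /sub h'; rewrite mem_set// mulr1.
  by rewrite lee_fin mulr_ge0 ?fisher_integrand_ge0.
have [h0|h0|->] := ltgtP h 0.
- have := sub (z + h) z; rewrite /sqrt_shift_sq -sqrrN opprB opprD addrA subrr add0r.
  rewrite ltr0_norm//; apply; first by rewrite gtrDl.
  by move=> y; rewrite ler_distl => /andP[]; lra.
- have := sub z (z + h); rewrite /sqrt_shift_sq addrAC subrr add0r.
  rewrite gtr0_norm//; apply; first by rewrite ltrDl.
  by move=> y; rewrite ler_distl => /andP[]; lra.
- by rewrite /sqrt_shift_sq addr0 subrr expr0n/= normr0 mul0e.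
Qed.

(** Integrating the pointwise bound over [z] in [D] and exchanging integrals, each [y] is counted
    with the measure of its band, at most [2 |h|], while a [y] in [E] is not counted since its band
    misses [D]. The other factor [|h|] comes from the pointwise bound. *)
Lemma integral_sqrt_shift_sq_le h (D E : set R) : measurable D -> measurable E ->
  (forall y z, E y -> D z -> `|y - z| <= `|h| -> False) ->
  (\int[mu]_(z in D) (sqrt_shift_sq h z)%:E <=
   (2 * h ^+ 2)%:E * \int[mu]_(y in ~` E) (fisher_integrand f y)%:E)%E.
Proof.
move=> mD mE DE; set phi := fisher_integrand f.
have phi0 y : 0 <= phi y by exact: fisher_integrand_ge0.
have mphi : measurable_fun setT phi by exact: measurable_fisher_integrand.
pose F (p : R * R) : \bar R :=
  ((phi p.2 * \1_[set p : R * R | `|p.2 - p.1| <= `|h|] p) * \1_D p.1)%:E.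
have F0 p : (0 <= F p)%E by rewrite lee_fin mulr_ge0 // mulr_ge0.
have mF : measurable_fun setT F.
  apply/measurable_EFinP; apply: measurable_funM; first apply: measurable_funM.
  - exact: measurableT_comp.
  - apply: measurable_indic; rewrite -[X in measurable X]setTI.
    apply: measurable_fun_le => //.
    by apply: measurableT_comp => //; apply: measurable_funB.
  - by apply: measurableT_comp => //; exact: measurable_indic.
have mFy y : measurable_fun setT (fun z => F (z, y)).
  by apply: measurableT_comp => //; exact: pair2_measurable.
apply: (@le_trans _ _ (`|h|%:E * \int[mu]_z \int[mu]_y F (z, y))%E).
  have mI : measurable_fun setT (fun z => \int[mu]_y F (z, y))%E.
    exact: measurable_fun_fubini_tonelli_F.
  have I0 z : (0 <= \int[mu]_y F (z, y))%E by apply: integral_ge0.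
  rewrite -ge0_integralZl_EFin// [leLHS]integral_mkcond; apply: ge0_le_integral => //.
  - by move=> z _; rewrite patchE; case: ifP => // _; rewrite lee_fin sqr_ge0.
  - apply/(measurable_restrictT _ _).1 => //; apply: (measurable_funS measurableT) => //.
    apply/measurable_EFinP; exact: measurable_sqrt_shift_sq.
  - exact: measurable_funeM.
  move=> z _; rewrite patchE; case: ifPn => [|_]; last first.
    by rewrite mule_ge0// lee_fin.
  rewrite inE => zD; apply: (le_trans (sqrt_shift_sq_le h z)).
  rewrite le_eqVlt; apply/orP; left; apply/eqP; congr (_ * _)%E.
  apply: eq_integral => y _; rewrite /F /= (indicE _ D) mem_set// mulr1.
  by rewrite !indicE.
rewrite fubini_tonelli//.
rewrite (_ : 2 * h ^+ 2 = `|h| * (2 * `|h|)); last first.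
  by rewrite -real_normK ?num_real// expr2; ring.
rewrite EFinM -muleA lee_wpmul2l ?lee_fin//.
have mphiE : measurable_fun setT ((EFin \o phi) \_ (~` E)).
  apply/(measurable_restrictT _ _).1; first exact: measurableC.
  by apply: (measurable_funS measurableT) => //; exact/measurable_EFinP.
have phiE0 y : (0 <= ((EFin \o phi) \_ (~` E)) y)%E.
  by rewrite patchE; case: ifP => // _; rewrite lee_fin.
rewrite [leRHS](_ : _ = (2 * `|h|)%:E * \int[mu]_y ((EFin \o phi) \_ (~` E)) y)%E; last first.
  by congr (_ * _)%E; rewrite integral_mkcond.
rewrite -ge0_integralZl_EFin ?mulr_ge0//.
apply: ge0_le_integral => //.
- by move=> y _; apply: integral_ge0.
- exact: measurable_fun_fubini_tonelli_G.
- exact: measurable_funeM.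
move=> y _; rewrite patchE; case: ifPn => [_|]; last first.
  rewrite notin_setE /= => /contrapT Ey; rewrite mule0.
  rewrite integral0_eq// => z _; rewrite /F /= !indicE.
  have [zD|] := boolP (z \in D); last by rewrite mulr0.
  have [|] := boolP (_ \in _); last by rewrite mulr0 mul0r.
  by rewrite inE /= => yz; case: (DE y z Ey _ yz); rewrite inE in zD.
apply: (@le_trans _ _ (\int[mu]_z ((phi y)%:E * (\1_[set z | `|z - y| <= `|h|] z)%:E))%E).
  apply: ge0_le_integral => //.
  - exact: mFy.
  - apply: measurable_funeM; apply/measurable_EFinP; apply: measurable_indic.
    exact: measurable_band.
  move=> z _; rewrite /F /= -EFinM lee_fin !indicE -mulrA ler_wpM2l//.
  have [|_] := boolP ((z, y) \in _); last by rewrite mul0r.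
  rewrite inE /= distrC => yz; rewrite mul1r [in leRHS]mem_set//.
  by case: (z \in D); rewrite ?lexx ?ler01.
rewrite ge0_integralZl_EFin//; last first.
  by apply/measurable_EFinP; apply: measurable_indic; exact: measurable_band.
rewrite integral_indic//; last exact: measurable_band.
rewrite setIT (_ : [set _ | _] = `[y - `|h|, y + `|h|]%classic); last first.
  by apply/seteqP; split => z; rewrite /= in_itv/= ler_distl.
have L : (mu `[(y - `|h|)%R, (y + `|h|)%R] <= (2 * `|h|)%:E)%E.
  rewrite lebesgue_measure_itv/= lte_fin; case: ifP => _.
    by rewrite -EFinB lee_fin; lra.
  by rewrite lee_fin mulr_ge0.
by rewrite [leRHS]muleC lee_wpmul2l// lee_fin.
Qed.

End shift_energy.

(** * Probability that a likelihood ratio exceeds the truncation level *)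

Section large_ratio.
Context (R : realType).
Notation mu := (@lebesgue_measure R).
Context (f : R -> R).
Hypothesis f0 : forall z, 0 <= f z.
Hypothesis f_derivable : forall z : R, derivable f z 1.
Hypothesis f'_cont : continuous (derive1 f).

(* [large_ratio h] stays away from [steady r] when [2 |h| < r], so that only the
   Fisher information off [steady r] contributes to its probability. *)
Definition steady (r : R) : set R :=
  [set y | forall z z', `|z - y| < r -> `|z' - y| < r -> f z <= 4 * f z'].

Definition large_ratio (h : R) : set R := [set z | 4 * f (z + h) < f z].

(** The definition quantifies over uncountably many points, but its complement is open: a violating
    pair [z], [z'] remains within [r] when the centre moves slightly. *)
Lemma measurable_steady r : measurable (steady r).
Proof.
apply: closed_measurable; rewrite -[steady r]setCK; apply: open_closedC.
rewrite openE => y /= /existsNP[z] /existsNP[z'] /not_implyP[zy].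
move=> /not_implyP[zy' /negP zz']; apply/nbhs_ballP.
exists (Num.min (r - `|z - y|) (r - `|z' - y|)).
  by rewrite /= lt_min !subr_gt0 zy.
move=> x; rewrite /ball/= lt_min => /andP[h1 h2] sx.
move/negP: zz'; apply; apply: sx.
  by apply: le_lt_trans (ler_distD y _ _) _; rewrite -ltrBrDl.
by apply: le_lt_trans (ler_distD y _ _) _; rewrite -ltrBrDl.
Qed.

Lemma pos_steady y : 0 < f y -> exists2 r, 0 < r & steady r y.
Proof.
move=> fy; have cf := density_continuous f_derivable.
(* Near [y] the values of [f] lie strictly between one half and three halves of [f y], so they
   differ by a factor below 3. *)
have f2 : 0 < f y / 2 by rewrite divr_gt0.
have /cvgrPdist_lt/(_ _ f2)/nbhs_ballP[r r0 H] := cf y.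
exists r => // z z' zy zy'.
have := H z; rewrite /ball/= distrC => /(_ zy); rewrite ltr_distl => /andP[h1 h2].
have := H z'; rewrite /ball/= distrC => /(_ zy'); rewrite ltr_distl => /andP[h3 h4].
by lra.
Qed.

(** As the radius shrinks, every point where [f] is positive becomes steady, and elsewhere the
    integrand is 0. Dominated convergence, with the finite Fisher information as dominating
    integral, gives the rest. *)
Lemma fisher_tail_small (tau : R) : (fisher_information f < +oo)%E -> 0 < tau ->
  exists2 r, 0 < r &
    (\int[mu]_(y in ~` steady r) (fisher_integrand f y)%:E <= tau%:E)%E.
Proof.
move=> If tau0; set phi := fisher_integrand f.
have phi0 y : 0 <= phi y by exact: fisher_integrand_ge0.
have mphi : measurable_fun setT phi by exact: measurable_fisher_integrand.
pose F (n : nat) : R -> \bar R := (EFin \o phi) \_ (~` steady (n.+1%:R^-1)).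
have mF n : measurable_fun setT (F n).
  apply/(measurable_restrictT _ _).1.
    by apply: measurableC; exact: measurable_steady.
  by apply: (measurable_funS measurableT) => //; exact/measurable_EFinP.
have : (\int[mu]_y F n y)%E @[n --> \oo] --> (\int[mu]_y cst 0%E y)%E.
  apply: (@dominated_cvg _ _ _ mu setT measurableT F (cst 0%E) (EFin \o phi)) => //.
  - move=> y _.
    have [fy|fy] := eqVneq (f y) 0.
      rewrite (_ : (fun n => F n y) = cst 0%E); first exact: cvg_cst.
      apply/funext => n; rewrite /F patchE; case: ifP => // _.
      by rewrite /= /phi /fisher_integrand fy mulr0.
    have fy0 : 0 < f y by rewrite lt_neqAle eq_sym fy f0.
    have [r r0 sy] := pos_steady fy0.
    apply: cvg_near_cst; near=> n; rewrite /F patchE.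
    have nr : n.+1%:R^-1 < r by near: n; exact: (near_infty_natSinv_lt (PosNum r0)).
    case: ifPn => //; rewrite inE /= => -[] z z' zy zy'.
    by apply: sy; [exact: lt_trans zy _|exact: lt_trans zy' _].
  - apply/integrableP; split; first exact/measurable_EFinP.
    by under eq_integral do rewrite gee0_abs ?lee_fin//.
  - move=> n y _; rewrite /F patchE; case: ifP => _.
      by rewrite gee0_abs// lee_fin.
    by rewrite abse0 lee_fin.
rewrite integral_cst// mul0e => cF.
have nb : nbhs (0%E : \bar R) [set x | (x < tau%:E)%E].
  apply: open_nbhs_nbhs; split; last by rewrite /= lte_fin.
  exact: open_ereal_lt_ereal.
have [n _ Hn] := cF _ nb.
exists (n.+1%:R^-1); first by rewrite invr_gt0.
by rewrite integral_mkcond; apply/ltW/Hn => /=.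
Unshelve. all: by end_near. Qed.

Lemma measurable_large_ratio h : measurable (large_ratio h).
Proof.
have mf : measurable_fun setT f.
  by apply: continuous_measurable_fun; exact: (density_continuous f_derivable).
rewrite (_ : large_ratio h = ~` (setT `&` [set z | f z <= 4 * f (z + h)])).
  apply: measurableC; apply: measurable_fun_le => //; apply: measurable_funM => //.
  have mh : measurable_fun setT (fun z : R => z + h) by exact: measurable_funD.
  exact: (measurableT_comp mf mh).
rewrite setTI; apply/seteqP; split => z; rewrite /large_ratio/= ltNge; first by move/negP.
by move/negP.
Qed.

(** On [large_ratio h] the square root of [f] at least halves between [z] and [z + h], so [f z] is
    at most 4 times its squared increment. The integral of the latter is [2 h^2] times a small
    Fisher information. *)
Lemma large_ratio_small (tau : R) : (fisher_information f < +oo)%E -> 0 < tau ->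
  exists2 r, 0 < r & forall h, `|h| < r ->
    (\int[mu]_(z in large_ratio h) (f z)%:E <= (tau * h ^+ 2)%:E)%E.
Proof.
(* The 8 compensates the 4 from the halving and the 2 from the band width. *)
move=> If tau0; have tau8 : 0 < tau / 8 by rewrite divr_gt0.
have [r r0 Hr] := fisher_tail_small If tau8.
exists (r / 2); first by rewrite divr_gt0.
move=> h hr; have mf : measurable_fun setT f.
  by apply: continuous_measurable_fun; exact: (density_continuous f_derivable).
have mD := measurable_large_ratio h.
have DE y z : steady r y -> large_ratio h z -> `|y - z| <= `|h| -> False.
  move=> sy; rewrite /large_ratio /= => Dz; rewrite distrC => yz.
  have : f z <= 4 * f (z + h).
    apply: sy; first by apply: le_lt_trans yz _; lra.
    rewrite addrAC; apply: le_lt_trans (ler_normD _ _) _; lra.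
  by rewrite leNgt Dz.
have E := integral_sqrt_shift_sq_le f0 f_derivable f'_cont mD (measurable_steady r) DE.
apply: (@le_trans _ _ (4%:E * \int[mu]_(z in large_ratio h) (sqrt_shift_sq f h z)%:E)%E).
  have ms : measurable_fun (large_ratio h) (fun z => (sqrt_shift_sq f h z)%:E).
    apply: (measurable_funS measurableT) => //; apply/measurable_EFinP.
    exact: measurable_sqrt_shift_sq.
  rewrite -ge0_integralZl_EFin//; last by move=> z _; rewrite lee_fin sqr_ge0.
  apply: ge0_le_integral => //.
  - by move=> z _; rewrite lee_fin.
  - by apply: (measurable_funS measurableT) => //; exact/measurable_EFinP.
  - exact: measurable_funeM.
  move=> z; rewrite /large_ratio/= => Dz; rewrite -EFinM lee_fin /sqrt_shift_sq.
  have a2 := sqr_sqrtr (f0 (z + h)); have b2 := sqr_sqrtr (f0 z).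
  have a0 := sqrtr_ge0 (f (z + h)); have b0 := sqrtr_ge0 (f z).
  move: Dz a2 b2 a0 b0; set a := Num.sqrt _; set b := Num.sqrt _ => Dz a2 b2 a0 b0.
  have ab : 2 * a <= b.
    by rewrite -(ler_pXn2r (n := 2))// ?nnegrE ?mulr_ge0// exprMn a2 b2; lra.
  rewrite -b2 (_ : 4 * (a - b) ^+ 2 = (2 * (b - a)) ^+ 2); last by ring.
  by rewrite lerXn2r// ?nnegrE; lra.
apply: (@le_trans _ _ (4%:E * ((2 * h ^+ 2)%:E * (tau / 8)%:E))%E).
  rewrite lee_wpmul2l ?lee_fin//; apply: le_trans E _.
  by rewrite lee_wpmul2l// lee_fin mulr_ge0// sqr_ge0.
by rewrite -!EFinM lee_fin; lra.
Qed.

End large_ratio.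

(** * Law and second moment of the truncated likelihood ratio of one observation *)

Section density.
Context (R : realType).
Notation mu := (@lebesgue_measure R).

Lemma lebesgue_measure_translate (h : R) (A : set R) : measurable A ->
  mu ((fun y => y - h) @^-1` A) = mu A.
Proof.
have mh : measurable_fun setT (fun y : R => y - h) by exact: measurable_funB.
pose nu : {measure set (measurableTypeR R) -> \bar R} :=
  pushforward mu (fun y : measurableTypeR R => y - h : measurableTypeR R).
move=> mA; suff H (Y : set R) : ocitv Y -> mu Y = nu mh Y.
  exact/esym/(lebesgue_measure_unique H mA).
move=> [[a b] _ <-] /=; rewrite /nu /= /pushforward.
rewrite (_ : _ @^-1` _ = `](a + h), (b + h)]%classic).
  rewrite !lebesgue_measure_itv/= !lte_fin ltrD2r.
  by case: ifP => // _; rewrite -!EFinB; congr EFin; ring.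
by apply/seteqP; split => y; rewrite /= !in_itv/= ltrBrDr lerBlDr.
Qed.

Lemma ge0_integral_translate (h : R) (G : R -> R) : measurable_fun setT G ->
  (forall z, 0 <= G z) -> (\int[mu]_y (G (y - h))%:E = \int[mu]_y (G y)%:E)%E.
Proof.
move=> mG G0.
have mh : measurable_fun setT (fun y : R => y - h) by exact: measurable_funB.
have := @ge0_integral_transport R _ _ _ _ _ _ mu mu (fun y : R => y - h) idfun
  (cst 1) (cst 1) G mh (@measurable_id _ _ _).
rewrite /cst/=; under eq_integral do rewrite mul1r.
move=> ->//; first by apply: eq_integral => y _; rewrite mul1r.
move=> A mA; under eq_integral do rewrite mul1r.
under [RHS]eq_integral do rewrite mul1r.
transitivity (mu A); last by rewrite -[RHS]/(\int[mu]_y (\1_A y)%:E)%E integral_indic// setIT.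
rewrite -[LHS]/(\int[mu]_y (\1_((fun y => y - h) @^-1` A) y)%:E)%E integral_indic//.
  by rewrite setIT; exact: lebesgue_measure_translate.
by rewrite -[X in measurable X]setTI; exact: mh.
Qed.

Context (d : measure_display) (T : measurableType d) (P : probability T R).
Context (X : {RV P >-> R}) (f : R -> R).
Hypothesis dX : has_density P X f.

Lemma integral_density (u : R -> R) : measurable_fun setT u -> (forall z, 0 <= u z) ->
  (\int[P]_w (u (X w))%:E = \int[mu]_z (f z * u z)%:E)%E.
Proof.
move=> mu' u0; have [mf f0 Pf] := dX.
have mX : measurable_fun setT X by exact: measurable_funPT.
have := @ge0_integral_transport R _ _ _ _ _ _ P mu X idfun (cst 1) f
  u mX (@measurable_id _ _ _).
under eq_integral do rewrite /cst mul1r.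
move=> ->// A mA; under eq_integral do rewrite mul1r.
rewrite -[LHS]/(\int[P]_y (\1_(X @^-1` A) y)%:E)%E integral_indic// ?setIT; last first.
  by rewrite -[X in measurable X]setTI; exact: mX.
rewrite [LHS](Pf A mA) [LHS]integral_mkcond; apply: eq_integral => z _.
by rewrite patchE indicE; case: ifP => _; rewrite ?mulr1 ?mulr0.
Qed.

Lemma integral_density1 : (\int[mu]_z (f z)%:E = 1)%E.
Proof.
have [_ _ /(_ _ measurableT)/esym] := dX; move=> ->.
by rewrite probability_setT.
Qed.

Hypothesis f_derivable : forall z : R, derivable f z 1.
Hypothesis f'_cont : continuous (derive1 f).

(** Density of [h + X] relative to [X], set to 0 where it exceeds 4. Where [f z = 0], passing the
    test forces [f (z - h) = 0], and the value is 0 in either branch. *)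
Definition truncated_ratio (h z : R) :=
  if f (z - h) <= 4 * f z then f (z - h) / f z else 0.

Let f0 z : 0 <= f z. Proof. by have [] := dX. Qed.

Let mfh (h : R) : measurable_fun setT (fun z : R => f (z - h)).
Proof.
have [mf _ _] := dX.
have mh : measurable_fun setT (fun z : R => z - h) by exact: measurable_funB.
exact: (measurableT_comp mf mh).
Qed.

Lemma truncated_ratio_bound h z : 0 <= truncated_ratio h z <= 4.
Proof.
rewrite /truncated_ratio; case: ifP => fz; last by rewrite lexx ler0n.
rewrite divr_ge0//=; have [->|z0] := eqVneq (f z) 0; first by rewrite invr0 mulr0.
by rewrite ler_pdivrMr// lt_neqAle eq_sym z0 f0.
Qed.

Lemma measurable_truncated_ratio h : measurable_fun setT (truncated_ratio h).
Proof.
have [mf _ _] := dX.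
apply: measurable_fun_ifT.
- by apply: measurable_fun_ler => //; exact: measurable_funM.
- apply: measurable_funM => //; apply: measurableT_comp => //.
  exact: measurable_inv_real.
- exact: measurable_cst.
Qed.

Lemma truncated_ratio_law h A : measurable A ->
  (\int[P]_w (\1_(~` large_ratio f h) (X w) * \1_A (h + X w))%:E =
   \int[P]_w (truncated_ratio h (X w) * \1_A (X w))%:E)%E.
Proof.
move=> mA; have [mf _ _] := dX.
have mD : measurable (~` large_ratio f h).
  by apply: measurableC; exact: measurable_large_ratio.
have mh : measurable_fun setT (fun z : R => h + z) by exact: measurable_funD.
have m1 : measurable_fun setT (fun z => \1_(~` large_ratio f h) z * \1_A (h + z) : R).
  apply: measurable_funM; first exact: measurable_indic.
  by apply: (measurableT_comp _ mh); exact: measurable_indic.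
rewrite (integral_density m1); last by move=> z; rewrite mulr_ge0.
rewrite (integral_density (u := fun z => truncated_ratio h z * \1_A z)); last 2 first.
- apply: measurable_funM; first exact: measurable_truncated_ratio.
  exact: measurable_indic.
- by move=> z; rewrite mulr_ge0//; case/andP: (truncated_ratio_bound h z).
(* In the coordinate of the shifted observation, lying off [large_ratio f h] becomes the test in
   [truncated_ratio]. *)
rewrite -(ge0_integral_translate h); last 2 first.
- exact: measurable_funM.
- by move=> z; rewrite !mulr_ge0.
apply: eq_integral => z _; congr EFin.
rewrite (addrC h) subrK /truncated_ratio !mulrA; congr (_ * _).
rewrite indicE; case: ifPn => fz.
  rewrite mem_set ?mulr1; last by rewrite /large_ratio/= subrK => /lt_geF; rewrite fz.
  have [z0|z0] := eqVneq (f z) 0; last by rewrite mulrC divfK.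
  by apply/eqP; rewrite z0 mul0r eq_le f0 andbT; rewrite z0 mulr0 in fz.
rewrite memNset ?mulr0//= ; apply; rewrite /large_ratio/= subrK.
by rewrite ltNge.
Qed.

(** The inequality [pw] is integrated: the left side gives the second moment plus 1, the right side
    2 plus a multiple of [h^2]. The constant 18 is 9 from [pw] times 2 from the band width. *)
Lemma truncated_ratio_sq_le h :
  (\int[P]_w (truncated_ratio h (X w) ^+ 2)%:E <=
   1 + (18 * h ^+ 2)%:E * fisher_information f)%E.
Proof.
have [mf _ _] := dX.
have mL2 : measurable_fun setT (fun z => truncated_ratio h z ^+ 2).
  by apply: measurable_funX; exact: measurable_truncated_ratio.
rewrite (integral_density mL2); last by move=> z; exact: sqr_ge0.
have S := @integral_sqrt_shift_sq_le R f f0 f_derivable f'_cont (- h) setT set0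
  measurableT measurable0 (fun _ _ F _ _ => F).
rewrite setC0 sqrrN -/(fisher_information f) in S.
(* The truncated chi-square distance is bounded by the squared Hellinger one. *)
have pw z : f z * truncated_ratio h z ^+ 2 + f z <=
    2 * f (z - h) + 9 * sqrt_shift_sq f (- h) z.
  rewrite /truncated_ratio /sqrt_shift_sq.
  have a2 := sqr_sqrtr (f0 (z - h)); have b2 := sqr_sqrtr (f0 z).
  have a0 := sqrtr_ge0 (f (z - h)); have b0 := sqrtr_ge0 (f z).
  move: a2 b2 a0 b0; set a := Num.sqrt _; set b := Num.sqrt _ => a2 b2 a0 b0.
  rewrite -a2 -b2; case: ifPn => ab.
    have {}ab : a <= 2 * b.
      by rewrite -(ler_pXn2r (n := 2))// ?nnegrE ?mulr_ge0// exprMn; lra.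
    have [bz|bz] := eqVneq b 0.
      by rewrite bz expr0n/= mul0r add0r addr_ge0// mulr_ge0// sqr_ge0.
    have bp : 0 < b by rewrite lt_neqAle eq_sym bz.
    (* The excess [a^4 / b^2 + b^2 - 2 a^2] equals [((a + b) / b)^2 (a - b)^2], and [a <= 2 b]
       bounds the first factor by 9. *)
    rewrite -lerBrDr -subr_ge0.
    rewrite (_ : _ - _ = (9 - ((a + b) / b) ^+ 2) * (a - b) ^+ 2); last by field.
    rewrite mulr_ge0 ?sqr_ge0// subr_ge0 (_ : 9 = 3 ^+ 2); last by ring.
    rewrite lerXn2r// ?nnegrE ?divr_ge0 ?addr_ge0// ler_pdivrMr//; lra.
  rewrite -ltNge in ab; rewrite expr0n/= mulr0 add0r.
  have := sqr_ge0 (a - b); have := sqr_ge0 b; lra.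
have ms := measurable_sqrt_shift_sq f_derivable (- h).
have m1 : measurable_fun setT (fun z : R => (2 * f (z - h))%:E).
  apply/measurable_EFinP; apply: measurable_funM; first exact: measurable_cst.
  exact: mfh.
have m2 : measurable_fun setT (fun z : R => (9 * sqrt_shift_sq f (- h) z)%:E).
  apply/measurable_EFinP; apply: measurable_funM; first exact: measurable_cst.
  exact: ms.
have I1 : (\int[mu]_z (f (z - h))%:E = 1)%E.
  by rewrite ge0_integral_translate// integral_density1.
rewrite -((@leeD2rE _ 1%E))// -{1}integral_density1 -ge0_integralD//; first last.
- exact/measurable_EFinP.
- by move=> z _; rewrite lee_fin.
- by apply/measurable_EFinP; exact: measurable_funM.
- by move=> z _; rewrite lee_fin mulr_ge0// sqr_ge0.
apply: (@le_trans _ _ (\int[mu]_z ((2 * f (z - h))%:E + (9 * sqrt_shift_sq f (- h) z)%:E))%E).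
  apply: ge0_le_integral => //.
  - by move=> z _; rewrite -EFinD lee_fin addr_ge0// mulr_ge0// sqr_ge0.
  - apply: emeasurable_funD; apply/measurable_EFinP; last exact: mf.
    exact: measurable_funM.
  - exact: emeasurable_funD.
  - by move=> z _; rewrite -!EFinD lee_fin.
rewrite ge0_integralD//; first last.
- by move=> z _; rewrite lee_fin mulr_ge0// sqr_ge0.
- by move=> z _; rewrite lee_fin mulr_ge0.
under eq_integral do rewrite EFinM.
rewrite ge0_integralZl_EFin//; first last.
- by apply/measurable_EFinP; exact: mfh.
- by move=> z _; rewrite lee_fin.
rewrite I1 mule1.
under eq_integral do rewrite EFinM.
rewrite ge0_integralZl_EFin//; first last.
- exact/measurable_EFinP.
- by move=> z _; rewrite lee_fin sqr_ge0.
rewrite addeAC -EFinD -[(1 + 1)%R]/(2%:R) leeD2l//.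
apply: (@le_trans _ _ (9%:E * ((2 * h ^+ 2)%:E * fisher_information f))%E).
  by rewrite lee_wpmul2l// lee_fin.
by rewrite muleA -EFinM mulrA -natrM.
Qed.

End density.

(** * Quantitative contiguity of shifted samples *)

Section contiguity.
Context (R : realType) (d : measure_display) (T : measurableType d).
Context (P : probability T R) (eps : nat -> {RV P >-> R}) (f : R -> R).
Hypothesis eps_indep : mutually_independent P eps.
Hypothesis eps_density : forall t, has_density P (eps t) f.
Hypothesis f_derivable : forall z : R, derivable f z 1.
Hypothesis f'_cont : continuous (derive1 f).
Hypothesis fisher_fin : (fisher_information f < +oo)%E.

(** Here [r] and [eta] depend on [e] and [C] only, uniformly in [n], the shifts and the event, so
    the bound can be used along a sequence of growing samples. *)
Lemma shifted_sample_small (e C : R) : 0 < e -> 0 <= C ->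
  exists2 r, 0 < r & exists2 eta, 0 < eta &
  forall n (h : nat -> R) (B : set (n.-tuple R)), measurable B ->
    (forall t, (t < n)%N -> `|h t| < r) -> \sum_(0 <= t < n) h t ^+ 2 <= C ->
    (P ((fun w => [tuple eps t w | t < n]) @^-1` B) <= eta%:E)%E ->
    (P ((fun w => [tuple (h t + eps t w)%R | t < n]) @^-1` B) <= e%:E)%E.
Proof.
move=> e0 C0.
have f0 z : 0 <= f z by have [] := eps_density 0%N.
have I0 : (0 <= fisher_information f)%E.
  by apply: integral_ge0 => z _; rewrite lee_fin fisher_integrand_ge0.
have Ifin : fisher_information f \is a fin_num by rewrite ge0_fin_numE.
pose I := fine (fisher_information f).
have {}I0 : 0 <= I by exact: fine_ge0.
(* Each of the three terms of [shifted_sample_le] is given [e / 3]. By [1 + x <= expR x], [E0]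
   bounds the product of second moments, which fixes [M]; [tau] handles the excess probabilities,
   with [C + 1] avoiding a zero denominator. *)
pose E0 := expR (18 * I * C); have E00 : 0 < E0 by exact: expR_gt0.
pose M := 3 * E0 / e; have M0 : 0 < M by rewrite divr_gt0// mulr_gt0.
pose tau := e / (3 * (C + 1)).
have C10 : 0 < C + 1 by rewrite ltr_wpDl.
have tau0 : 0 < tau by rewrite divr_gt0// mulr_gt0.
have [r r0 Hr] := large_ratio_small f0 f_derivable f'_cont fisher_fin tau0.
exists r => //; exists (e / (3 * M)); first by rewrite divr_gt0// mulr_gt0.
move=> n h B mB hr hC PB.
have := @shifted_sample_le _ _ _ _ _ eps_indep n h (fun t => large_ratio f (h t))
  (fun t => truncated_ratio f (h t)) 4 M B
  (fun t => measurable_large_ratio f_derivable (h t))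
  (fun t => measurable_truncated_ratio (eps_density 0%N) (h t))
  (fun t z => truncated_ratio_bound (eps_density 0%N) (h t) z)
  (fun t A mA => truncated_ratio_law (eps_density t) f_derivable (h t) mA) mB M0.
move/le_trans; apply.
rewrite (_ : e = e / 3 + (e / 3 + e / 3)); last by field.
rewrite 2!EFinD; apply: leeD; last apply: leeD.
- apply: (@le_trans _ _ (\sum_(0 <= t < n) (tau * h t ^+ 2)%:E)%E).
    rewrite big_seq [leRHS]big_seq; apply: lee_sum => t.
    rewrite mem_index_iota => /= tn; have [_ _ dt] := eps_density t.
    have := dt _ (measurable_large_ratio f_derivable (h t)).
    by rewrite /distribution/= /pushforward => ->; apply/Hr/hr.
  rewrite sumEFin lee_fin -mulr_sumr.
  apply: (@le_trans _ _ (tau * (C + 1))).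
    by apply: ler_wpM2l; [exact: ltW|apply: (le_trans hC); rewrite lerDl].
  by rewrite le_eqVlt; apply/orP; left; apply/eqP; rewrite /tau; field; rewrite lt0r_neq0.
- apply: (@le_trans _ _ (M%:E * (e / (3 * M))%:E)%E).
    by rewrite lee_wpmul2l// lee_fin ltW.
  rewrite -EFinM lee_fin le_eqVlt; apply/orP; left; apply/eqP.
  by field; rewrite lt0r_neq0.
- apply: (@le_trans _ _ (M^-1%:E * E0%:E)%E).
    rewrite lee_wpmul2l ?lee_fin ?invr_ge0 ?(ltW M0)//.
    apply: (@le_trans _ _ (\prod_(0 <= t < n) (expR (18 * I * h t ^+ 2))%:E)%E).
      (* Nonnegativity is carried along because multiplying the inequalities requires it. *)
      suff [] : (0 <= \prod_(0 <= t < n)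
            \int[P]_w (truncated_ratio f (h t) (eps t w) ^+ 2)%:E)%E /\
          (\prod_(0 <= t < n) \int[P]_w (truncated_ratio f (h t) (eps t w) ^+ 2)%:E <=
           \prod_(0 <= t < n) (expR (18 * I * h t ^+ 2))%:E)%E by [].
      elim/big_ind2 : _ => [|x1 x2 y1 y2 [x0 x12] [y0 y12]|t _].
        by rewrite lee_fin ler01.
        by split; [exact: mule_ge0|exact: lee_pmul].
      split; first by apply: integral_ge0 => w _; rewrite lee_fin sqr_ge0.
      apply: (le_trans (truncated_ratio_sq_le (eps_density t) f_derivable f'_cont (h t))).
      rewrite -(fineK Ifin) -EFinM -EFinD lee_fin -/I.
      by rewrite mulrAC; exact: expR_ge1Dx.
    rewrite prodEFin lee_fin -expR_sum ler_expR -mulr_sumr.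
    by rewrite ler_wpM2l// mulr_ge0.
  rewrite -EFinM lee_fin le_eqVlt; apply/orP; left; apply/eqP.
  by rewrite /M; field; rewrite !lt0r_neq0.
Qed.

End contiguity.

(** * Consequences of converging averages, and a convergence criterion *)

Section averages.
Context (R : realType).

(* With [v n] the average of [u 0, ..., u n.-1],
   [u t = (t + 1) v (t + 1) - t v t <= c + (2 t + 1) e]. *)
Lemma cvg_average_max_small (u : nat -> R) (c : R) :
  (forall t, 0 <= u t) ->
  (fun n => n%:R^-1 * \sum_(0 <= t < n) u t) @ \oo --> c ->
  forall e, 0 < e -> \forall n \near \oo, forall t, (t < n)%N -> u t / n%:R < e.
Proof.
move=> u0 uc e e0; set v := (fun n => _) in uc.
have e4 : 0 < e / 4 by rewrite divr_gt0.
have sv n : (0 < n)%N -> \sum_(0 <= t < n) u t = n%:R * v n.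
  by move=> n0; rewrite /v mulVKf// pnatr_eq0 -lt0n.
have /cvgrPdist_lt/(_ _ e4)[N0 _ HN0] := uc.
pose N := N0.+1.
have HN n : (N <= n)%N -> c - e / 4 < v n < c + e / 4.
  move=> Nn; have := HN0 n (ltnW Nn); rewrite distrC ltr_distl.
  by rewrite /=.
pose S := \sum_(0 <= t < N) u t.
near=> n => t tn.
have n0 : 0 < n%:R :> R by rewrite ltr0n (leq_ltn_trans _ tn).
(* One threshold serves both cases: [u t <= S] for [t < N], and [u t <= c + (2 t + 1) e / 4] with
   [t + 1 <= n] for the other indices. *)
have cn : `|c| + S < n%:R * (e / 4).
  by rewrite -ltr_pdivrMr//; near: n; exact: nbhs_infty_gtr.
rewrite ltr_pdivrMr//.
have S0 : 0 <= S by exact: sumr_ge0.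
have cc : c <= `|c| by exact: ler_norm.
have en : n%:R * (e / 4) <= e * n%:R by have := mulr_gt0 n0 e4; lra.
have [tN|Nt] := ltnP t N.
  apply: (@le_lt_trans _ _ S); last by have := normr_ge0 c; lra.
  rewrite /S (bigD1_seq t) ?iota_uniq ?mem_index_iota//=.
  by rewrite lerDl sumr_ge0.
have st1 := sv t.+1 isT; have st := sv t (leq_ltn_trans (leq0n _) Nt).
rewrite big_nat_recr//= st -natr1 in st1.
have /andP[_ h1] := HN t.+1 (leqW Nt); have /andP[h2 _] := HN t Nt.
have tn' : t%:R + 1 <= n%:R :> R by rewrite natr1 ler_nat.
have t0 : 0 <= t%:R :> R by [].
have : u t = (t%:R + 1) * v t.+1 - t%:R * v t by rewrite -st1; ring.
have k1 : (t%:R + 1) * v t.+1 <= (t%:R + 1) * (c + e / 4).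
  by rewrite ler_wpM2l ?addr_ge0// ltW.
have k2 : t%:R * (c - e / 4) <= t%:R * v t by rewrite ler_wpM2l// ltW.
have k3 : (t%:R + 1) * (e / 4) <= n%:R * (e / 4) by rewrite ler_wpM2r// ltW.
by move=> ->; lra.
Unshelve. all: by end_near. Qed.

Lemma cvg_quadratic_average k (x : nat -> 'cV[R]_k) (Q : 'M[R]_k) (s : 'cV[R]_k) :
  (fun n : nat => n%:R^-1 *: \sum_(t < n) x t *m (x t)^T) @ \oo --> Q ->
  (fun n => n%:R^-1 * \sum_(0 <= t < n) (((x t)^T *m s) ord0 ord0) ^+ 2) @ \oo -->
  (s^T *m Q *m s) ord0 ord0.
Proof.
move=> cQ.
have E (A : 'M[R]_k) : (s^T *m A *m s) ord0 ord0 =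
    \sum_i (\sum_j s j ord0 * A j i) * s i ord0.
  by rewrite mxE; apply: eq_bigr => i _; rewrite mxE; congr (_ * _);
     apply: eq_bigr => j _; rewrite mxE.
have -> : (fun n => n%:R^-1 * \sum_(0 <= t < n) (((x t)^T *m s) ord0 ord0) ^+ 2) =
   (fun n => (s^T *m (n%:R^-1 *: \sum_(t < n) x t *m (x t)^T) *m s) ord0 ord0).
  apply/funext => n; rewrite -scalemxAr -scalemxAl [RHS]mxE; congr (_ * _).
  rewrite mulmx_sumr mulmx_suml summxE big_mkord; apply: eq_bigr => t _.
  rewrite (_ : s^T *m _ *m s = (s^T *m x t) *m ((x t)^T *m s)); last by rewrite !mulmxA.
  rewrite [RHS]mxE big_ord1 expr2; congr (_ * _).
  by rewrite -[in RHS](trmxK (x t)) -trmx_mul [RHS]mxE.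
rewrite E; under eq_fun do rewrite E.
apply: cvg_big; [exact: add_continuous|] => i _; apply: cvgM; last exact: cvg_cst.
apply: cvg_big; [exact: add_continuous|] => j _; apply: cvgM; first exact: cvg_cst.
by apply: (cvg_comp _ (fun M : 'M[R]_k => M j i) cQ); exact: coord_continuous.
Qed.

(** Tailored to the maximal risk, which never exceeds the supremum of the loss: only eventual lower
    bounds remain to be shown, whether [L] is finite or not. *)
Lemma ge0_cvg_of_lower_bounds (u : nat -> \bar R) (L : \bar R) : (0 <= L)%E ->
  (forall n, u n <= L)%E ->
  (forall a : R, (a%:E < L)%E -> \forall n \near \oo, (a%:E <= u n)%E) ->
  u @ \oo --> L.
Proof.
case: L => [r||//] r0 uL H; last by apply/cvgeyPge => A; apply: H; exact: ltry.
apply/fine_cvgP; split.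
  have [n1 _ Hn1] : \forall n \near \oo, ((r - 1)%:E <= u n)%E.
    by apply: H; rewrite lte_fin ltrBlDr ltrDl.
  exists n1 => // n /Hn1 h; rewrite fin_numE; apply/andP; split; apply/eqP => un.
    by rewrite un in h.
  by have := uL n; rewrite un.
apply/cvgrPdist_le => e e0.
have [n1 _ Hn1] : \forall n \near \oo, ((r - e)%:E <= u n)%E.
  by apply: H; rewrite lte_fin ltrBlDr ltrDl.
exists n1 => // n /Hn1 /=; have := uL n; case: (u n) => //= a.
rewrite !lee_fin => ar ra; rewrite ger0_norm; lra.
Qed.

End averages.

(** * Borel measurability on column vectors *)

Section borelRk_theory.
Context (R : realType) (k : nat).

Lemma borelRk_open (A : set 'cV[R]_k) : open A -> measurable (A : set (borelRk R k)).
Proof. by move=> oA; apply: sub_gen_smallest. Qed.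

Lemma continuous_measurable_borelRk (phi : 'cV[R]_k -> 'cV[R]_k) : continuous phi ->
  measurable_fun [set: borelRk R k] (phi : borelRk R k -> borelRk R k).
Proof.
move=> /continuousP cphi.
apply: (@measurability _ _ (borelRk R k) (borelRk R k) setT phi
  (@open 'cV[R]_k)) => // _ [A oA <-].
by rewrite setTI; apply: borelRk_open; exact: cphi.
Qed.

Lemma continuous_measurable_borelRk_real (g : 'cV[R]_k -> R) : continuous g ->
  measurable_fun [set: borelRk R k] (g : borelRk R k -> R).
Proof.
move=> /continuousP cg.
apply: (measurability (@RGenOInfty.G R)); first exact: RGenOInfty.measurableE.
move=> _ [_ [x ->] <-].
by rewrite setTI; apply: borelRk_open; apply: cg; exact: interval_open.
Qed.

Lemma measurable_borelRk_neq0 : measurable ([set v | v != 0] : set (borelRk R k)).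
Proof.
apply: borelRk_open; rewrite (_ : [set v | _] = ~` [set 0]).
  by apply: closed_openC; apply: accessible_closed_set1; apply: hausdorff_accessible;
     exact: norm_hausdorff.
by apply/seteqP; split => v /= /eqP.
Qed.

Definition sqnorm (v : 'cV[R]_k) : R := (v^T *m v) ord0 ord0.

Lemma sqnormE v : sqnorm v = \sum_i v i ord0 ^+ 2.
Proof. by rewrite /sqnorm mxE; apply: eq_bigr => i _; rewrite mxE expr2. Qed.

Lemma measurable_sqnorm : measurable_fun [set: borelRk R k] (sqnorm : borelRk R k -> R).
Proof.
rewrite (_ : sqnorm = fun v => \sum_i v i ord0 ^+ 2); last first.
  by apply/funext => v; exact: sqnormE.
apply: measurable_sum => i; apply: measurable_funX.
apply: (continuous_measurable_borelRk_real (g := fun v => v i ord0)).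
exact: coord_continuous.
Qed.

End borelRk_theory.

(** * Sparse estimators along local parameters, and their maximal risk *)

Section sparse_estimator.
Context (R : realType) (k : nat) (x : nat -> 'cV[R]_k) (Q : 'M[R]_k).
Hypothesis cvg_Q :
  (fun n : nat => n%:R^-1 *: \sum_(t < n) x t *m (x t)^T) @ \oo --> Q.
Context (d : measure_display) (T : measurableType d) (P : probability T R).
Context (eps : nat -> {RV P >-> R}) (f : R -> R).
Hypothesis eps_indep : mutually_independent P eps.
Hypothesis eps_density : forall t, has_density P (eps t) f.
Hypothesis f_derivable : forall z : R, derivable f z 1.
Hypothesis f'_cont : continuous (derive1 f).
Hypothesis fisher_fin : (fisher_information f < +oo)%E.
Context (hat : forall n : nat, n.-tuple R -> 'cV[R]_k).
Arguments hat : clear implicits.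
Hypothesis hat_measurable : forall n : nat,
  measurable_fun [set: n.-tuple R] (hat n : n.-tuple R -> borelRk R k).
Hypothesis hat_sparse0 :
  (fun n : nat => sample_law P x eps n 0
     [set y | forall i, (nonzero_pattern (hat n y) i ord0 <=
                         nonzero_pattern (0 : 'cV[R]_k) i ord0)%N]) @ \oo --> 1%E.

Definition local_parameter (s : 'cV[R]_k) n : 'cV[R]_k := - ((Num.sqrt n%:R)^-1 *: s).

Definition nonzero_estimate n : set (n.-tuple R) := [set y | hat n y != 0].
Arguments nonzero_estimate : clear implicits.

Lemma measurable_nonzero_estimate n : measurable (nonzero_estimate n).
Proof.
rewrite -[X in measurable X]setTI.
exact: (hat_measurable measurableT (@measurable_borelRk_neq0 R k)).
Qed.

(** At the parameter 0 the pattern is identically 0, so the sparsity event is exactly the event that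
    the estimate is 0. *)
Lemma nonzero_estimate_null (eta : R) : 0 < eta ->
  \forall n \near \oo, (sample_law P x eps n 0 (nonzero_estimate n) <= eta%:E)%E.
Proof.
move=> eta0.
have nb : nbhs (1%E : \bar R) [set y | ((1 - eta)%:E < y)%E].
  apply: open_nbhs_nbhs; split; last by rewrite /= lte_fin ltrBlDr ltrDl.
  exact: open_ereal_gt_ereal.
have [N _ HN] := hat_sparse0 nb.
exists N => // n /HN /=.
rewrite (_ : [set y | _] = ~` nonzero_estimate n); last first.
  apply/seteqP; split => y /=.
    move=> H; apply/negP; rewrite negbK; apply/eqP/colP => i.
    by have := H i; rewrite !mxE eqxx/= leqn0 eqb0 negbK => /eqP.
  by move/negP; rewrite negbK => /eqP -> i; rewrite !mxE eqxx.
have mB := @measurable_nonzero_estimate n.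
rewrite probability_setC//.
have fB : sample_law P x eps n 0 (nonzero_estimate n) \is a fin_num by exact: fin_num_measure.
by rewrite -(fineK fB) -EFinB lte_fin => h; rewrite -[leLHS](fineK fB) lee_fin; lra.
Qed.

(** The squared shifts are [(x_t' s)^2 / n]. Their sum converges to [s' Q s], hence is eventually at
    most [|c| + 1], and convergence of these averages also forces the largest shift to 0. *)
Lemma nonzero_estimate_local_null (s : 'cV[R]_k) (e : R) : 0 < e ->
  \forall n \near \oo,
    (sample_law P x eps n (local_parameter s n) (nonzero_estimate n) <= e%:E)%E.
Proof.
move=> e0; pose u t := (((x t)^T *m s) ord0 ord0) ^+ 2.
pose c := (s^T *m Q *m s) ord0 ord0.
have cu : (fun n => n%:R^-1 * \sum_(0 <= t < n) u t) @ \oo --> c.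
  exact: cvg_quadratic_average.
have C0 : 0 <= `|c| + 1 by rewrite addr_ge0.
have [r r0 [eta eta0 H]] := shifted_sample_small eps_indep eps_density
  f_derivable f'_cont fisher_fin e0 C0.
have u0 t : 0 <= u t by exact: sqr_ge0.
have r20 : 0 < r ^+ 2 by rewrite exprn_gt0.
near=> n.
have n0 : (0 < n)%N by near: n; exact: nbhs_infty_gt.
have nR : 0 < n%:R :> R by rewrite ltr0n.
pose h t := ((x t)^T *m local_parameter s n) ord0 ord0.
have h2 t : h t ^+ 2 = u t / n%:R.
  rewrite /h /u /local_parameter mulmxN -scalemxAr mxE mxE sqrrN exprMn exprVn.
  by rewrite sqr_sqrtr// mulrC.
apply: (H n h _ (@measurable_nonzero_estimate n)).
- move=> t tn; rewrite -(@ltr_pXn2r _ 2)// ?nnegrE ?ltW// real_normK ?num_real// h2.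
  move: t tn; near: n; exact: (cvg_average_max_small u0 cu r20).
- under eq_bigr do rewrite h2; rewrite -mulr_suml mulrC.
  near: n; apply: cvgr_le cu _ _.
  by apply: le_lt_trans (ler_norm c) _; rewrite ltrDl.
- have -> : (fun w => [tuple eps t w | t < n]) = sample x eps n 0.
    apply/funext => w; apply: eq_from_tnth => i.
    by rewrite !tnth_mktuple mulmx0 mxE add0r.
  by near: n; exact: nonzero_estimate_null.
Unshelve. all: by end_near. Qed.

Lemma cvg_maximal_risk (l : 'cV[R]_k -> R) : (forall s, 0 <= l s) ->
  measurable_fun [set: borelRk R k] (l : borelRk R k -> R) ->
  (fun n : nat => ereal_sup (range (fun theta : 'cV[R]_k =>
     (\int[sample_law P x eps n theta]_y
        (l (Num.sqrt n%:R *: (hat n y - theta)))%:E)%E)))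
    @ \oo --> ereal_sup (range (fun s : 'cV[R]_k => (l s)%:E)).
Proof.
move=> l0 ml.
have mloss n theta : measurable_fun setT
    (fun y : n.-tuple R => (l (Num.sqrt n%:R *: (hat n y - theta)))%:E).
  pose phi (v : 'cV[R]_k) := Num.sqrt n%:R *: (v - theta).
  have cphi : continuous phi.
    move=> v; have cB : {for v, continuous (id - cst theta : 'cV[R]_k -> 'cV[R]_k)}.
      by apply: continuousB; [exact: cvg_id|exact: cst_continuous].
    exact: (continuousZ (@cst_continuous _ _ (Num.sqrt n%:R) v) cB).
  apply/measurable_EFinP; apply: (measurableT_comp ml).
  exact: (measurableT_comp (continuous_measurable_borelRk cphi) (@hat_measurable n)).
apply: ge0_cvg_of_lower_bounds.
- by apply: (@le_trans _ _ (l 0)%:E); [rewrite lee_fin|apply: ereal_sup_ubound; exists 0].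
- move=> n; apply: ge_ereal_sup => _ [theta _ <-].
  (* Under a probability measure the mean loss cannot exceed the supremum of the loss. *)
  set L := ereal_sup _.
  have lL v : ((l v)%:E <= L)%E by apply: ereal_sup_ubound; exists v.
  apply: (@le_trans _ _ (\int[sample_law P x eps n theta]_y L)%E).
    apply: ge0_le_integral => //; first by move=> y _; rewrite lee_fin.
    exact: mloss.
  by rewrite integral_cst// [X in (_ * X)%E]probability_setT mule1.
move=> a /ereal_sup_gt[_ [s _ <-]]; rewrite lte_fin => als.
have [e e0 ae] : exists2 e : R, 0 < e & a <= l s * (1 - e).
  (* With this [e], the claim [a <= l s * (1 - e)] reduces to [a <= l s]; adding 1 keeps the
     denominator positive when [l s = 0]. *)
  exists ((l s - a) / (l s + 1)); first by rewrite divr_gt0 ?subr_gt0// ltr_wpDl.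
  have l1 : 0 < l s + 1 by rewrite ltr_wpDl.
  rewrite (_ : 1 - _ = (1 + a) / (l s + 1)); last by field; rewrite lt0r_neq0.
  by rewrite mulrA ler_pdivlMr//; nra.
near=> n; have n0 : (0 < n)%N by near: n; exact: nbhs_infty_gt.
have BL : (sample_law P x eps n (local_parameter s n) (nonzero_estimate n) <= e%:E)%E.
  by near: n; exact: nonzero_estimate_local_null.
pose theta := local_parameter s n.
apply: (@le_trans _ _ (\int[sample_law P x eps n theta]_y
  (l (Num.sqrt n%:R *: (hat n y - theta)))%:E)%E); last first.
  by apply: ereal_sup_ubound; exists theta.
have mB := @measurable_nonzero_estimate n.
apply: (@le_trans _ _ (\int[sample_law P x eps n theta]_(y in ~` nonzero_estimate n)
  (l s)%:E)%E).
  rewrite integral_cst; last exact: measurableC.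
  rewrite [X in (_ * X)%E](probability_setC (sample_law P x eps n theta) mB).
  have fB : sample_law P x eps n theta (nonzero_estimate n) \is a fin_num.
    exact: fin_num_measure.
  move: BL; rewrite -/theta -(fineK fB) -EFinB -EFinM !lee_fin => Be.
  by apply: (le_trans ae); rewrite ler_wpM2l// lerB.
apply: (@le_trans _ _ (\int[sample_law P x eps n theta]_(y in ~` nonzero_estimate n)
  (l (Num.sqrt n%:R *: (hat n y - theta)))%:E)%E).
  rewrite le_eqVlt; apply/orP; left; apply/eqP; apply: eq_integral => y.
  rewrite inE /nonzero_estimate /= => /negP; rewrite negbK => /eqP ->.
  rewrite sub0r /theta /local_parameter opprK scalerA divff ?scale1r//.
  by rewrite gt_eqF// sqrtr_gt0 ltr0n.
apply: ge0_subset_integral => //; [exact: measurableC|exact: mloss|].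
by move=> y _; rewrite lee_fin.
Unshelve. all: by end_near. Qed.

End sparse_estimator.

Theorem theorem2p1 (R : realType) (k : nat) (k_ge1 : (1 <= k)%N)
    (x : nat -> 'cV[R]_k) (Q : 'M[R]_k)
    (Q_posdef : positive_definite Q)
    (cvg_Q : (fun n : nat => n%:R^-1 *: \sum_(t < n) x t *m (x t)^T) @ \oo --> Q)
    (d : measure_display) (T : measurableType d) (P : probability T R)
    (eps : nat -> {RV P >-> R}) (f : R -> R)
    (eps_indep : mutually_independent P eps)
    (eps_density : forall t, has_density P (eps t) f)
    (eps_mean : forall t, ('E_P[eps t] = 0)%E)
    (eps_variance : forall t, ('V_P[eps t] = 1)%E)
    (f_derivable : forall z, derivable f z 1)
    (f'_ac : absolutely_continuous (derive1 f))
    (fisher_f : (0 < fisher_information f < +oo)%E)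
    (hat : forall n : nat, n.-tuple R -> 'cV[R]_k)
    (hat_measurable : forall n : nat,
      measurable_fun [set: n.-tuple R] (hat n : n.-tuple R -> borelRk R k))
    (hat_sparse : forall theta : 'cV[R]_k,
      (fun n : nat => sample_law P x eps n theta
         [set y | forall i, (nonzero_pattern (hat n y) i ord0 <=
                             nonzero_pattern theta i ord0)%N]) @ \oo
        --> 1%E) :
  [/\ (fun n : nat => ereal_sup (range (fun theta : 'cV[R]_k =>
         (\int[sample_law P x eps n theta]_y
            (n%:R * ((hat n y - theta)^T *m (hat n y - theta)) ord0 ord0)%:E)%E)))
        @ \oo --> +oo%E,
      forall l : 'cV[R]_k -> R,
        (forall s, 0 <= l s) ->
        measurable_fun [set: borelRk R k] (l : borelRk R k -> R) ->
        (fun n : nat => ereal_sup (range (fun theta : 'cV[R]_k =>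
           (\int[sample_law P x eps n theta]_y
              (l (Num.sqrt n%:R *: (hat n y - theta)))%:E)%E)))
          @ \oo --> ereal_sup (range (fun s : 'cV[R]_k => (l s)%:E))
    & forall l : 'cV[R]_k -> R,
        (forall s, 0 <= l s) ->
        measurable_fun [set: borelRk R k] (l : borelRk R k -> R) ->
        (forall M : R, exists s, M < l s) ->
        (fun n : nat => ereal_sup (range (fun theta : 'cV[R]_k =>
           (\int[sample_law P x eps n theta]_y
              (l (Num.sqrt n%:R *: (hat n y - theta)))%:E)%E)))
          @ \oo --> +oo%E].
Proof.
have f'_cont := absolutely_continuous_continuous f'_ac.
have /andP[_ fisher_fin] := fisher_f.
have risk := cvg_maximal_risk cvg_Q eps_indep eps_density f_derivable f'_cont
  fisher_fin hat_measurable (hat_sparse 0).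
have unbounded (l : 'cV[R]_k -> R) : (forall s, 0 <= l s) ->
    measurable_fun [set: borelRk R k] (l : borelRk R k -> R) ->
    (forall M : R, exists s, M < l s) ->
    (fun n : nat => ereal_sup (range (fun theta : 'cV[R]_k =>
       (\int[sample_law P x eps n theta]_y
          (l (Num.sqrt n%:R *: (hat n y - theta)))%:E)%E))) @ \oo --> +oo%E.
  move=> l0 ml lub; have := risk l l0 ml.
  rewrite (_ : ereal_sup (range (fun s : 'cV[R]_k => (l s)%:E)) = +oo%E)//.
  apply/eqyP => M M0; have [s Ms] := lub M.
  apply: (@le_trans _ _ (l s)%:E); first by rewrite lee_fin ltW.
  by apply: ereal_sup_ubound; exists s.
split => //.
(* Mean squared error is the risk for the loss [sqnorm]: the factor [n] is the square of the scaling
   inside the loss. *)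
have := unbounded (@sqnorm R k).
under [X in _ -> _ -> _ -> X @ _ --> _]eq_fun => n.
  rewrite (_ : (fun theta => _) = (fun theta : 'cV[R]_k =>
    (\int[sample_law P x eps n theta]_y
      (n%:R * ((hat n y - theta)^T *m (hat n y - theta)) ord0 ord0)%:E)%E)); last first.
    apply/funext => theta; apply: eq_integral => y _; congr EFin.
    rewrite /sqnorm linearZ/= linearZ/= -scalemxAl scalerA -expr2 sqr_sqrtr //.
    by rewrite [LHS]mxE.
  over.
apply.
- by move=> s; rewrite sqnormE sumr_ge0// => i _; rewrite sqr_ge0.
- exact: measurable_sqnorm.
(* One coordinate, available because [k >= 1], already contributes [(|M| + 1)^2 > M]. *)
move=> M; exists (const_mx (`|M| + 1)); rewrite sqnormE.
rewrite (bigD1 (Ordinal k_ge1))//= mxE.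
apply: (@lt_le_trans _ _ ((`|M| + 1) ^+ 2)); last first.
  by rewrite lerDl sumr_ge0// => i _; rewrite sqr_ge0.
have := ler_norm M; have := normr_ge0 M; nra.
Qed.
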